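(* Let $\mathcal G=\langle S_\Diamond,S_\Box,\overline s,A,\delta\rangle$ be a stochastic game, $\phi=\mathtt{R}^r_{\ge b}[\mathtt{C}]$ a property, and $(\psi,\tau)$ a (static or dynamic) penalty scheme. Let $\theta$ be a multi-strategy sound for $\phi$. For any $\varepsilon>0$ there exist a positive integer $M$ and a multi-strategy $\theta'$ of granularity $M$ that is sound for $\phi$ and satisfies $\mathit{pen}_\tau(\theta')-\mathit{pen}_\tau(\theta)\le\varepsilon$. Moreover, for static penalties ($\tau=\mathit{sta}$) it suffices to take $M=\big\lceil\sum_{s\in S,a\in A(s)}\frac{\psi(s,a)}{\varepsilon}\big\rceil$.
   Context: A (turn-based) stochastic game is a tuple $\mathcal{G}=\langle S_\Diamond,S_\Box,\overline{s},A,\delta\rangle$, where $S=S_\Diamond\cup S_\Box$ is a finite set of states partitioned into controller states $S_\Diamond$ and environment states $S_\Box$, $\overline{s}$ the initial state, $A$ a finite set of actions, and $\delta:S\times A\to\mathrm{Dist}(S)$ a partial function with rational probabilities; $A(s)=\{a\mid\delta(s,a)\text{ defined}\}$. Strategies are memoryless: $\sigma:S_\Diamond\to\mathrm{Dist}(A)$, $\pi:S_\Box\to\mathrm{Dist}(A)$, supported on enabled actions, inducing the standard probability measure on paths. A reward structure is $r:S\times A\to\mathbb{Q}_{\ge 0}$; $E^{\sigma,\pi}_{\mathcal G,s}(r)$ is the expectation of $\sum_{j\ge0}r(s_j,a_j)$; it is assumed $\sup_{\sigma,\pi}E^{\sigma,\pi}_{\mathcal G,s}(r)<\infty$. $\phi=\mathtt{R}^r_{\ge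 b}[\mathtt{C}]$ is satisfied under $(\sigma,\pi)$ iff $E^{\sigma,\pi}_{\mathcal G,\overline s}(r)\ge b$; $\sigma$ is sound for $\phi$ if this holds for all $\pi$. A multi-strategy is $\theta:S_\Diamond\to\mathrm{Dist}(2^A)$ with $\theta(s)(\emptyset)=0$ (sets at $s$ are subsets of $A(s)$); it has granularity $M$ if every probability $\theta(s)(B)$ is an integer multiple of $\frac1M$. $\sigma$ complies with $\theta$ ($\sigma\triangleleft\theta$) if for every $s\in S_\Diamond$ and nonempty $B\subseteq A(s)$ there is $d_{s,B}\in\mathrm{Dist}(B)$ with $\sigma(s)(a)=\sum_{B\ni a}\theta(s)(B)d_{s,B}(a)$ for all $a\in A(s)$; $\theta$ is sound for $\phi$ if every $\sigma\triangleleft\theta$ is sound. A penalty scheme is $(\psi,\tau)$ with $\psi:S_\Diamond\times A\to\mathbb{Q}_{\ge0}$ (in the sum over $s\in S$ above, $\psi(s,a)$ is taken to be $0$ for $s\in S_\Box$) and $\tau\in\{\mathit{sta},\mathit{dyn}\}$. Local penalty: $\mathit{pen}_{loc}(\theta,s)=\sum_{B\subseteq A(s)}\sum_{a\in A(s)\setminus B}\theta(s)(B)\psi(s,a)$. Static: $\mathit{pen}_{sta}(\theta)=\sum_{s\in S_\Diamond}\mathit{pen}_{loc}(\theta,s)$. Dynamic: with $r_\theta(s,a)=\mathit{pen}_{loc}(\theta,s)$ for $s\in S_\Diamond$ and $0$ for $s\in S_\Box$, $\mathit{pen}_{dyn}(\theta)=\sup\{E^{\sigma,\pi}_{\mathcal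 G,\overline s}(r_\theta)\mid\sigma\triangleleft\theta,\pi\}$.
   Formalization: For static penalties M is taken as the maximum of 1 and ⌈Σψ(s,a)/ε⌉, because when ψ vanishes on all enabled actions the stated ceiling is 0, which is not a positive granularity; otherwise M is exactly the stated ceiling. *)

(* Defs.v *)
From HB Require Import structures.
From mathcomp Require Import all_boot all_order all_algebra.
From mathcomp Require Import all_classical all_reals all_analysis.

Set Implicit Arguments.
Unset Strict Implicit.
Unset Printing Implicit Defensive.

Import Order.TTheory GRing.Theory Num.Theory.

Local Open Scope classical_set_scope.
Local Open Scope ring_scope.

Record dist (R : numDomainType) (T : finType) := Dist {
  dist_fun :> T -> R;
  dist_ge0 : forall x, 0 <= dist_fun x;
  dist_sum1 : \sum_x dist_fun x = 1 }.

Lemma dist_inhabited (R : numDomainType) (T : finType) (p : dist R T) :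
  exists x : T, xpredT x.
Proof.
have [T0|/card_gt0P[x _]] := posnP #|T|; last by exists x.
have := dist_sum1 p; rewrite big_pred0 => [/esym/eqP|x].
  by rewrite oner_eq0.
by have := card0_eq T0 x; rewrite !inE.
Qed.

Definition dist_point (R : numDomainType) (T : finType) (p : dist R T) : T :=
  xchoose (dist_inhabited p).

(** Infinite sequences over a finite alphabet, with the sigma-algebra generated
    by cylinders.  The letter [x0] only serves to make the type pointed. *)

Definition infseq (X : finType) (x0 : X) : Type := nat -> X.

HB.instance Definition _ (X : finType) (x0 : X) := Choice.on (infseq x0).
HB.instance Definition _ (X : finType) (x0 : X) :=
  isPointed.Build (infseq x0) (fun=> x0).

Definition cylinder (X : finType) (x0 : X) (w : seq X) : set (infseq x0) :=
  [set x | mkseq x (size w) = w].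

Definition infseq_meas (X : finType) (x0 : X) :=
  g_sigma_algebraType (range (@cylinder X x0)).

Section cylinder_extension.
Variables (R : realType) (X : finType) (x0 : X) (p : seq X -> R).
Hypothesis p_ge0 : forall w, 0 <= p w.
Hypothesis p_nil : p [::] = 1.
Hypothesis p_rcons : forall w, p w = \sum_x p (rcons w x).

(* The measure is the image of Lebesgue measure on [0, 1[ under the coding map
   of nested interval subdivisions; words are stored in reverse. *)
Let q (w : seq X) : R := p (rev w).
Let nx (i : nat) : X := nth x0 (enum X) i.
Let S (w : seq X) (k : nat) : R := \sum_(0 <= i < k) q (nx i :: w).

Fixpoint left_end (w : seq X) : R :=
  if w is x :: w' then left_end w' + S w' (index x (enum X)) else 0.

Let I (w : seq X) : set R := [set` `[left_end w, left_end w + q w[].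

Let q_ge0 w : 0 <= q w. Proof. exact: p_ge0. Qed.

Let SS w k : S w k.+1 = S w k + q (nx k :: w).
Proof. by rewrite /S big_nat_recr. Qed.

Let S_mono w k l : (k <= l)%N -> S w k <= S w l.
Proof.
move=> kl; rewrite /S (big_cat_nat (leq0n k) kl)/= lerDl.
by apply: sumr_ge0 => i _.
Qed.

Let S_total w : S w #|X| = q w.
Proof.
transitivity (\sum_(x <- enum X) q (x :: w)).
  by rewrite (big_nth x0) -cardE.
by rewrite big_enum /= /q p_rcons; apply: eq_bigr => x _; rewrite rev_cons.
Qed.

Let nx_index x : nx (index x (enum X)) = x.
Proof. by rewrite /nx nth_index // mem_enum. Qed.

Let SSx w x : S w (index x (enum X)).+1 = S w (index x (enum X)) + q (x :: w).
Proof. by rewrite SS nx_index. Qed.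

Let I_sub x w : I (x :: w) `<=` I w.
Proof.
move=> u; rewrite /I /= !in_itv /= => /andP[h1 h2]; apply/andP; split.
  apply: le_trans h1; rewrite lerDl; exact: sumr_ge0.
apply: lt_le_trans h2 _; rewrite -addrA -SSx lerD2l -S_total; apply: S_mono.
by rewrite cardE index_mem mem_enum.
Qed.

Let I_inj x y w u : I (x :: w) u -> I (y :: w) u -> x = y.
Proof.
rewrite /I /= !in_itv /= -!addrA -!SSx => /andP[a1 a2] /andP[b1 b2].
have H (k l : nat) : left_end w + S w k <= u -> u < left_end w + S w l.+1 ->
    (k <= l)%N.
  move=> h1 h2; rewrite leqNgt; apply/negP => /(S_mono w) h3.
  by have := lt_le_trans h2 (le_trans (lerD (lexx _) h3) h1); rewrite ltxx.
have /(congr1 nx) : index x (enum X) = index y (enum X).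
  by apply/eqP; rewrite eqn_leq (H _ _ a1 b2) (H _ _ b1 a2).
by rewrite !nx_index.
Qed.

Let I_cover w u : I w u -> exists x, I (x :: w) u.
Proof.
rewrite /I /= in_itv /= -S_total => /andP[h1 h2].
have [k kX hk] : exists2 k, (k < #|X|)%N &
    left_end w + S w k <= u < left_end w + S w k.+1.
  elim: #|X| h2 => [|n IH] h2.
    by move: h2; rewrite /S big_geq // addr0 ltNge h1.
  have [h|h] := leP (left_end w + S w n) u; first by exists n; rewrite ?h.
  by have [k kn hk] := IH h; exists k => //; rewrite ltnS ltnW.
exists (nx k).
rewrite /= in_itv /= -addrA -SSx /nx index_uniq ?enum_uniq //.
by rewrite -cardE.
Qed.

Let next (u : R) (w : seq X) : X :=
  odflt x0 [pick x | u \in `[left_end (x :: w), left_end (x :: w) + q (x :: w)[].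

Let pre (u : R) (n : nat) : seq X := iter n (fun w => next u w :: w) [::].

Definition coding (u : R) : infseq_meas x0 := fun n => next u (pre u n).

Let pre_mkseq u n : rev (pre u n) = mkseq (coding u) n.
Proof.
elim: n => // n IH; rewrite /mkseq -addn1 iotaD map_cat -/(mkseq _ n) -IH.
by rewrite addn1 /= rev_cons cats1.
Qed.

Let I_nil : I [::] = [set` `[0%R, 1%R[].
Proof. by rewrite /I /= /q /= p_nil add0r. Qed.

Let pre_I u n : I [::] u -> I (pre u n) u.
Proof.
move=> u01; elim: n => // n /I_cover[x hx] /=.
rewrite /next; case: pickP => [y hy|/(_ x)]; first exact: hy.
by move=> h; have : false by rewrite -h; exact: hx.
Qed.

Let I_pre u w : I w u -> pre u (size w) = w.
Proof.
elim: w => // x w IH h /=; rewrite (IH (I_sub h)); congr cons.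
rewrite /next; case: pickP => [y hy|/(_ x)].
  exact: I_inj hy h.
by move=> h'; have : false by rewrite -h'; exact: h.
Qed.

Let I_sub0 w : I w `<=` I [::].
Proof. by elim: w => // x w IH; apply: subset_trans IH; exact: I_sub. Qed.

Let coding_in w : [set` `[0%R, 1%R[] `&` coding @^-1` (cylinder (rev w)) = I w.
Proof.
rewrite -I_nil; apply/seteqP; split=> [u [u01]|u hu].
  rewrite /cylinder /= -pre_mkseq size_rev => /(can_inj revK) <-.
  exact: pre_I.
split; first exact: I_sub0 hu.
by rewrite /cylinder /= -pre_mkseq size_rev I_pre.
Qed.

Let pre_out u n : ~ I [::] u -> pre u n = nseq n x0.
Proof.
move=> h; elim: n => // n IH /=; rewrite {}IH; congr cons.
rewrite /next; case: pickP => // x hx; exfalso; apply: h.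
exact: (@I_sub0 (x :: nseq n x0)).
Qed.

Let measurable_coding : measurable_fun setT (coding : measurableTypeR R -> infseq_meas x0).
Proof.
apply: (@measurability _ _ (measurableTypeR R) (infseq_meas x0) _ coding
  (range (@cylinder X x0))) => //.
move=> _ [_ [w _ <-] <-]; rewrite setTI -(revK w); set C := _ @^-1` _.
rewrite -(setIT C) -(setUv [set` `[0%R, 1%R[]) setIUr.
apply: measurableU; first by rewrite setIC coding_in; exact: measurable_itv.
have outE u : ~ [set` `[0%R, 1%R[] u -> C u = (rev (nseq (size w) x0) = w).
  move=> nu; rewrite /C /cylinder /= revK -pre_mkseq pre_out //.
  by rewrite I_nil.
have [h|h] := pselect (rev (nseq (size w) x0) = w).
  rewrite setIidr; last by move=> u nu; rewrite outE.
  by apply: measurableC; exact: measurable_itv.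
rewrite (_ : _ `&` _ = set0) //; apply/seteqP; split=> // u [Cu nu].
by apply: h; rewrite -(outE _ nu).
Qed.

Lemma cylinder_extension :
  exists P : probability (infseq_meas x0) R,
    forall w, P (cylinder w) = (p w)%:E.
Proof.
pose mD : measurable ([set` `[0%R, 1%R[] : set (measurableTypeR R)) :=
  measurable_itv _.
pose mu := mrestr (@lebesgue_measure R) mD.
pose m : {measure set (infseq_meas x0) -> \bar R} :=
  measure_function_pushforward__canonical__measure_function_Measure
    mu measurable_coding.
have mE w : m (cylinder w) = (p w)%:E.
  rewrite /m /= /pushforward /mu /mrestr setIC -(revK w) coding_in.
  rewrite /I lebesgue_measure_itv /= lte_fin ltrDl.
  case: ltP => [_|h]; first by rewrite -EFinB addrC addKr /q.
  by congr EFin; apply/eqP; rewrite eq_le h p_ge0.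
have mT : m setT = 1%E.
  rewrite (_ : setT = cylinder [::]) ?mE ?p_nil //.
  by apply/seteqP; split => // x _; rewrite /cylinder.
pose P : probability (infseq_meas x0) R := mnormalize m (dirac point).
exists P => w; rewrite /P /= /mnormalize mT /= gt_eqF ?lte01 //=.
by rewrite invr1 mule1 mE.
Qed.

End cylinder_extension.

Record game (Sd Sb A : finType) := Game {
  init : Sd + Sb;
  delta : Sd + Sb -> A -> option (dist rat (Sd + Sb)%type) }.

Section game_defs.
Variables (R : realType) (Sd Sb A : finType) (G : game Sd Sb A).

Local Notation state := (Sd + Sb)%type.

Definition enabled (s : state) (a : A) : bool := isSome (delta G s a).

Record strategy (X : Type) (emb : X -> state) := Strategy {
  strat_fun :> X -> dist R A;
  strat_enabled : forall x a, ~~ enabled (emb x) a -> strat_fun x a = 0 }.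

Definition ctrl_strategy := strategy (@inl Sd Sb).
Definition env_strategy := strategy (@inr Sd Sb).

Section paths.
Variables (sigma : ctrl_strategy) (pi : env_strategy).

Definition act (s : state) : dist R A :=
  match s with inl x => sigma x | inr y => pi y end.

Definition trans (s : state) (a : A) (t : state) : R :=
  if delta G s a is Some d then ratr (d t) else 0.

(* Probability that the path s_0 a_0 s_1 a_1 ... starts with the word [w], when
   s_0 has law [mu]. *)
Fixpoint word_prob (mu : state -> R) (w : seq (state * A)) : R :=
  if w is (t, a) :: w' then mu t * act t a * word_prob (trans t a) w' else 1.

Definition start (s t : state) : R := (t == s)%:R.

Lemma act_enabled s a : ~~ enabled s a -> act s a = 0.
Proof. by case: s => x /=; exact: strat_enabled. Qed.

Lemma trans_ge0 s a t : 0 <= trans s a t.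
Proof.
by rewrite /trans; case: (delta G s a) => // d; rewrite ler0q dist_ge0.
Qed.

Lemma trans_sum1 s a : enabled s a -> \sum_t trans s a t = 1.
Proof.
rewrite /enabled /trans; case: (delta G s a) => // d _.
by rewrite -raddf_sum /= dist_sum1 rmorph1.
Qed.

Lemma start_sum1 s : \sum_t start s t = 1.
Proof.
rewrite (bigD1 s) //= /start eqxx big1 ?addr0 // => t /negbTE ->.
by [].
Qed.

Lemma word_prob_ge0 mu w : (forall t, 0 <= mu t) -> 0 <= word_prob mu w.
Proof.
elim: w mu => [|[t a] w IH] mu mu0 //=; rewrite !mulr_ge0 ?dist_ge0 //.
by apply: IH => u; exact: trans_ge0.
Qed.

Lemma word_prob_rcons mu w : \sum_t mu t = 1 ->
  word_prob mu w = \sum_x word_prob mu (rcons w x).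
Proof.
elim: w mu => [|[t a] w IH] mu mu1 /=.
  transitivity (\sum_t \sum_a mu t * act t a).
    by rewrite -mu1; apply: eq_bigr => t _; rewrite -mulr_sumr dist_sum1 mulr1.
  by rewrite pair_bigA /=; apply: eq_bigr => -[t a] _; rewrite mulr1.
rewrite -mulr_sumr; have [en|/act_enabled ->] := boolP (enabled t a).
  by rewrite -IH // trans_sum1.
by rewrite mulr0 !mul0r.
Qed.

(* Any letter will do, see [infseq]. *)
Definition path_point (s : state) : state * A := (s, dist_point (act s)).

Definition path_space (s : state) := infseq_meas (path_point s).

Lemma path_measure_exists (s : state) :
  exists P : probability (path_space s) R,
    forall w, P (cylinder w) = (word_prob (start s) w)%:E.
Proof.
apply: cylinder_extension => // w.
  by apply: word_prob_ge0 => t; exact: ler0n.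
exact/word_prob_rcons/start_sum1.
Qed.

(* The cylinders form a pi-system generating the sigma-algebra, so the chosen
   measure is the only one with these cylinder probabilities. *)
Definition path_measure (s : state) : probability (path_space s) R :=
  sval (cid (path_measure_exists s)).

Definition expected (s : state) (rho : state -> A -> R) : \bar R :=
  (\int[path_measure s]_x \sum_(0 <= j <oo) (rho (x j).1 (x j).2)%:E)%E.

End paths.

Section soundness.
Variables (r : state -> A -> rat) (b : R).

Definition reward_expectation (sigma : ctrl_strategy) (pi : env_strategy)
    (s : state) : \bar R :=
  expected sigma pi s (fun t a => ratr (r t a)).

Definition sup_reward_finite : Prop :=
  forall s, (ereal_sup [set v | exists sigma pi,
    v = reward_expectation sigma pi s] < +oo)%E.

Definition sound (sigma : ctrl_strategy) : Prop :=
  forall pi : env_strategy, (b%:E <= reward_expectation sigma pi (init G))%E.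

End soundness.

Record multistrategy := Multistrategy {
  ms_fun :> Sd -> dist R {set A};
  ms_nonempty : forall s, ms_fun s finset.set0 = 0;
  ms_enabled : forall s (B : {set A}),
    ~~ (B \subset enabled (inl s)) -> ms_fun s B = 0 }.

Definition granular (M : nat) (theta : multistrategy) : Prop :=
  forall s B, exists k : int, theta s B = k%:~R / M%:R.

(* d_(s,B), a distribution on B, is given as a distribution on A vanishing
   outside B. *)
Definition complies (sigma : ctrl_strategy) (theta : multistrategy) : Prop :=
  exists d : Sd -> {set A} -> dist R A,
    (forall s (B : {set A}), B != finset.set0 -> B \subset enabled (inl s) ->
       forall a, a \notin B -> d s B a = 0) /\
    (forall s a, enabled (inl s) a ->
       sigma s a = \sum_(B : {set A} | a \in B) theta s B * d s B a).

Definition ms_sound (r : state -> A -> rat) (b : R) (theta : multistrategy)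
    : Prop :=
  forall sigma, complies sigma theta -> sound r b sigma.

Section penalties.
Variable psi : Sd -> A -> rat.

Definition psi_ext (s : state) (a : A) : rat :=
  if s is inl x then psi x a else 0.

Definition pen_loc (theta : multistrategy) (s : Sd) : R :=
  \sum_(B : {set A} | B \subset enabled (inl s))
    \sum_(a | enabled (inl s) a && (a \notin B)) theta s B * ratr (psi s a).

Definition pen_sta (theta : multistrategy) : R := \sum_s pen_loc theta s.

Definition pen_reward (theta : multistrategy) (s : state) (a : A) : R :=
  if s is inl x then pen_loc theta x else 0.

Definition pen_dyn (theta : multistrategy) : \bar R :=
  ereal_sup [set v | exists sigma pi, complies sigma theta /\
    v = expected sigma pi (init G) (pen_reward theta)].

End penalties.

End game_defs.

Inductive penalty_type := sta | dyn.

Definition pen (R : realType) (Sd Sb A : finType) (G : game Sd Sb A)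
    (psi : Sd -> A -> rat) (tau : penalty_type) (theta : multistrategy R G)
    : \bar R :=
  match tau with sta => (pen_sta psi theta)%:E | dyn => pen_dyn psi theta end.

(* Main.v *)
Require Import Defs.
From mathcomp Require Import all_boot all_order all_algebra.
From mathcomp Require Import all_classical all_reals all_analysis.
From mathcomp Require Import measurable_realfun.
From mathcomp Require Import zify ring lra.

(** Let V be the value of the reward game in which a minimising opponent picks
    the actions inside the sets drawn from theta: V is the least fixed point of
    the Bellman operator, so b <= V at the initial state by soundness. Write
    v(s, B) for the least one-step value of an action of B at s. If at each s
    theta' has mean of v(s, .) at least that of theta, then V is a subsolution
    for theta'. A subsolution bounds the expected total reward from below unless
    the play can be trapped in a set of states where the rewards vanish and V is
    a positive constant. Trapping is excluded if theta' uses, at each s, a set B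
    with v(s, B) larger than the mean, or a fixed set Bst(s) of the support of
    theta chosen so that the opponent cannot stay for free inside {V > 0}.

    Static penalties: theta(s) is replaced by a mixture of two sets, no worse for
    both v and the penalty, whose weights are rounded towards the set with the
    larger v. This moves at most 1/M of the mass.

    Dynamic penalties: for large M, rounding down all weights but the one of the
    set with the largest v keeps the support and changes the probabilities by
    factors in [1/c, c]. By eliminating the states of the induced chains one by
    one, expected total rewards then change by a factor at most c^K with K
    depending only on the number of states. *)

Set Implicit Arguments.
Unset Strict Implicit.
Unset Printing Implicit Defensive.

Import Order.TTheory GRing.Theory Num.Theory.
Import numFieldNormedType.Exports.
Local Open Scope classical_set_scope.
Local Open Scope ring_scope.

(** * Minimum of a function over a finite set *)

Section min_over_set.
Variables (R : realFieldType) (T : finType) (h : T -> R).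

Definition vmin (B : {set T}) : R :=
  if [pick a in B] is Some a0 then h [arg min_(a < a0 in B) h a]%O else 0.

Lemma vmin_le (B : {set T}) a : a \in B -> vmin B <= h a.
Proof.
rewrite /vmin; case: pickP => [a0 a0B aB|B0]; last by rewrite B0.
by case: arg_minP => // i iB; apply.
Qed.

Lemma vmin_attained (B : {set T}) :
  B != finset.set0 -> exists2 a, a \in B & h a = vmin B.
Proof.
rewrite /vmin; case: pickP => [a0 a0B _|B0].
  by case: arg_minP => // i iB _; exists i.
by case/set0Pn => x; rewrite B0.
Qed.

End min_over_set.

(** Makes a power of a factor close to 1 explicitly close to 1. The constant 3 comes from
    [(1 + x) (1 + k x) <= 1 + 3 k x], valid as [x x <= x] and [1 <= k]. *)
Lemma expr1D_le (R : realFieldType) (x : R) (n : nat) :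
  0 <= x <= 1 -> (1 + x) ^+ n <= 1 + 3 ^+ n * x.
Proof.
move=> /andP[x0 x1]; elim: n => [|n IH]; first by rewrite !expr0 mul1r lerDl.
have h3 : 1 <= 3 ^+ n :> R by apply: exprn_ege1; lra.
rewrite exprS (le_trans (ler_wpM2l _ IH)) //; first by lra.
rewrite exprS; set k := 3 ^+ n in h3 *.
have : k * (x * x) <= k * x by rewrite ler_wpM2l; nra.
nra.
Qed.

(** * Perturbation of supersolutions by state elimination *)

Section elimination.
Variable R : realFieldType.

(** The rerouted term picks up one factor [c] from each of [p], [v] and the inverse of [g], hence
    the cube. *)
Lemma elim_term_le (c u u' p p' v v' g g' : R) :
  1 <= c -> 0 <= u -> 0 <= p -> 0 <= p' -> 0 <= v -> 0 <= v' -> 0 < g -> 0 < g' ->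
  u' <= c * u -> p' <= c * p -> v' <= c * v -> g <= c * g' ->
  u' + p' * v' / g' <= c ^+ 3 * (u + p * v / g).
Proof.
move=> c1 u0 p0 p'0 v0 v'0 g0 g'0 uu pp vv gg; rewrite mulrDr; apply: lerD.
  apply: le_trans uu _; rewrite ler_wpM2r // -[leLHS]expr1.
  by rewrite ler_weXn2l.
have hg : g'^-1 <= c * g^-1.
  by rewrite -[leLHS]mul1r ler_pdivrMr // mulrAC ler_pdivlMr // mul1r.
have -> : c ^+ 3 * (p * v / g) = (c * p) * (c * v) * (c * g^-1) by ring.
by rewrite !ler_pM // ?mulr_ge0 // invr_ge0 ltW.
Qed.

(* State elimination: removing x reroutes the mass entering x along the exits
   of x, whose total mass is 1 - P x x; as this is itself a sum of transition
   weights, entrywise factors c only grow to c ^ 3. *)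
Lemma supersolution_perturbation (T : finType) (X : {set T}) (c : R)
    (P P' : T -> T -> R) (e e' r r' U : T -> R) :
  1 <= c ->
  (forall s t, 0 <= P s t) -> (forall s t, 0 <= P' s t) ->
  (forall s, 0 <= e s) -> (forall s, 0 <= e' s) ->
  (forall s, 0 <= r s) -> (forall s, 0 <= r' s) -> (forall s, 0 <= U s) ->
  (forall s, s \in X -> e s + \sum_(t in X) P s t = 1) ->
  (forall s, s \in X -> e' s + \sum_(t in X) P' s t = 1) ->
  (forall s t, P' s t <= c * P s t) -> (forall s t, P s t <= c * P' s t) ->
  (forall s, e' s <= c * e s) -> (forall s, e s <= c * e' s) ->
  (forall s, r' s <= c * r s) ->
  (forall s, s \in X -> r s + \sum_(t in X) P s t * U t <= U s) ->
  exists U' : T -> R, [/\ forall s, 0 <= U' s,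
    forall s, s \in X -> r' s + \sum_(t in X) P' s t * U' t <= U' s &
    forall s, s \in X -> U' s <= c ^+ (3 ^ #|X|).-1 * U s].
Proof.
elim: {X}#|X| {-2}X (erefl #|X|) c P P' e e' r r' => [|n IH] X Xn c P P' e e' r r'.
  move=> *; exists (fun=> 0); split=> // s.
    by rewrite (cards0_eq Xn) inE.
  by rewrite (cards0_eq Xn) inE.
move=> c1 P0 P'0 e0 e'0 r0 r'0 U0 eP eP' P'P PP' e'e ee' r'r hU.
have /set0Pn[x xX] : X != finset.set0 by rewrite -cards_eq0 Xn.
set Y := X :\ x.
have Yn : n = #|Y| by move: (cardsD1 x X); rewrite xX Xn add1n => -[].
have splitX (F : T -> R) : \sum_(t in X) F t = F x + \sum_(t in Y) F t.
  rewrite (bigD1 x) //=; congr (_ + _); apply: eq_bigl => t.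
  by rewrite !inE andbC.
have YX s : s \in Y -> s \in X by rewrite inE => /andP[].
have Yx s : s \in X -> s != x -> s \in Y by rewrite !inE => -> ->.
have c0 : 0 < c by lra.
pose g := e x + \sum_(t in Y) P x t.
pose g' := e' x + \sum_(t in Y) P' x t.
have gE : g = 1 - P x x by rewrite -(eP _ xX) splitX /g; ring.
have g'E : g' = 1 - P' x x by rewrite -(eP' _ xX) splitX /g'; ring.
have gg' : g <= c * g'.
  by rewrite /g /g' mulrDr mulr_sumr lerD // ler_sum.
have g'g : g' <= c * g.
  by rewrite /g /g' mulrDr mulr_sumr lerD // ler_sum.
have g_ge0 : 0 <= g by rewrite addr_ge0 // sumr_ge0.
(* Degenerate case: x is absorbing for [P], hence for [P']. The supersolution inequality then forces
   its reward to vanish, so x gets the value 0 and the mass entering it is counted in the exit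
   weights. *)
have [g0|gn0] := eqVneq g 0.
  have P1 : P x x = 1 by lra.
  have g'0 : g' = 0.
    apply/eqP; rewrite eq_le addr_ge0 ?sumr_ge0 // andbT.
    by rewrite (le_trans g'g) // g0 mulr0.
  have P'1 : P' x x = 1 by lra.
  have Pz : forall t, t \in Y -> P' x t = 0.
    move=> t tY; apply/eqP; rewrite eq_le P'0 andbT -g'0 /g' (bigD1 t) //=.
    by rewrite addrCA lerDl addr_ge0 // sumr_ge0.
  have r'x : r' x = 0.
    have rx : r x <= 0.
      have := hU _ xX; rewrite splitX P1 mul1r.
      have : 0 <= \sum_(t in Y) P x t * U t by rewrite sumr_ge0 // => *; rewrite mulr_ge0.
      by lra.
    by apply/eqP; rewrite eq_le r'0 andbT (le_trans (r'r x)) // pmulr_rle0.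
  have [||||||||||U' [U'0 U's U'U]] :=
      IH Y (esym Yn) c P P' (fun s => e s + P s x) (fun s => e' s + P' s x) r r' c1 P0 P'0 _ _ r0 r'0 U0.
  - by move=> s; rewrite addr_ge0.
  - by move=> s; rewrite addr_ge0.
  - by move=> s /YX /eP; rewrite splitX addrA.
  - by move=> s /YX /eP'; rewrite splitX addrA.
  - exact: P'P.
  - exact: PP'.
  - by move=> s; rewrite mulrDr lerD.
  - by move=> s; rewrite mulrDr lerD.
  - exact: r'r.
  - move=> s /YX sX; apply: le_trans (hU _ sX); rewrite splitX.
    by rewrite lerD2l lerDr mulr_ge0.
  exists (fun s => if s == x then 0 else U' s); split.
  - by move=> s; case: ifP.
  - move=> s sX; rewrite splitX eqxx mulr0 add0r.
    rewrite (eq_bigr (fun t => P' s t * U' t)); last first.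
      by move=> t; rewrite !inE => /andP[/negbTE->].
    case: eqVneq => [->|sx]; last exact/U's/Yx.
    by rewrite r'x add0r big1 // => t tY; rewrite Pz // mul0r.
  - move=> s sX; case: eqVneq => [_|sx].
      by rewrite mulr_ge0 // exprn_ge0 // ltW.
    apply: le_trans (U'U _ (Yx _ sX sx)) _; rewrite ler_wpM2r //.
    by rewrite -Yn Xn ler_weXn2l // -!subn1 leq_sub2r // leq_exp2l.
have gp : 0 < g by rewrite lt_def gn0.
have g'p : 0 < g' by move: (lt_le_trans gp gg'); rewrite pmulr_rgt0.
have hx : (r x + \sum_(t in Y) P x t * U t) / g <= U x.
  rewrite ler_pdivrMr // gE.
  by have := hU _ xX; rewrite splitX; lra.
have dist_elim (Q : T -> T -> R) (f : T -> R) d s : 0 < d ->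
    f x + \sum_(t in Y) Q x t = d -> f s + \sum_(t in X) Q s t = 1 ->
    f s + Q s x * f x / d + \sum_(t in Y) (Q s t + Q s x * Q x t / d) = 1.
  move=> d0 fd <-; rewrite splitX big_split /=.
  have -> : \sum_(t in Y) Q s x * Q x t / d = Q s x * (d - f x) / d.
    by rewrite -mulr_suml -mulr_sumr -fd; congr (_ * _ / _); ring.
  by field; rewrite gt_eqF.
have reward_elim (Q : T -> T -> R) (f W : T -> R) d s :
    f s + Q s x * f x / d + \sum_(t in Y) (Q s t + Q s x * Q x t / d) * W t =
    f s + Q s x * ((f x + \sum_(t in Y) Q x t * W t) / d) + \sum_(t in Y) Q s t * W t.
  rewrite (eq_bigr (fun t => Q s t * W t + Q s x / d * (Q x t * W t))); last first.
    by move=> t _; ring.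
  by rewrite big_split /= -mulr_sumr; ring.
have divg_ge0 (u v : R) : 0 <= u -> 0 <= v -> 0 <= u * v / g.
  by move=> u0 v0; rewrite !mulr_ge0 // invr_ge0 ltW.
have divg'_ge0 (u v : R) : 0 <= u -> 0 <= v -> 0 <= u * v / g'.
  by move=> u0 v0; rewrite !mulr_ge0 // invr_ge0 ltW.
have [|||||||||||||||U' [U'0 U's U'U]] := IH Y (esym Yn) (c ^+ 3)
  (fun s t => P s t + P s x * P x t / g) (fun s t => P' s t + P' s x * P' x t / g')
  (fun s => e s + P s x * e x / g) (fun s => e' s + P' s x * e' x / g')
  (fun s => r s + P s x * r x / g) (fun s => r' s + P' s x * r' x / g') _ _ _ _ _ _ _ U0.
- exact: exprn_ege1.
- by move=> s t; rewrite addr_ge0 // divg_ge0.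
- by move=> s t; rewrite addr_ge0 // divg'_ge0.
- by move=> s; rewrite addr_ge0 // divg_ge0.
- by move=> s; rewrite addr_ge0 // divg'_ge0.
- by move=> s; rewrite addr_ge0 // divg_ge0.
- by move=> s; rewrite addr_ge0 // divg'_ge0.
- by move=> s /YX sX; apply: dist_elim => //; exact: eP.
- by move=> s /YX sX; apply: dist_elim => //; exact: eP'.
- by move=> s t; apply: elim_term_le.
- by move=> s t; apply: elim_term_le.
- by move=> s; apply: elim_term_le.
- by move=> s; apply: elim_term_le.
- by move=> s; apply: elim_term_le.
- move=> s /YX sX; rewrite reward_elim; apply: le_trans (hU _ sX).
  by rewrite splitX addrA lerD2r lerD2l ler_wpM2l.
(* Back substitution: [ux] solves the equation at x when the other values are [U']. *)
pose ux := (r' x + \sum_(t in Y) P' x t * U' t) / g'.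
have ux0 : 0 <= ux.
  rewrite divr_ge0 // ?(ltW g'p) // addr_ge0 // sumr_ge0 // => t _.
  by rewrite mulr_ge0.
exists (fun s => if s == x then ux else U' s); split.
- by move=> s; case: ifP.
- move=> s sX; rewrite splitX eqxx.
  rewrite (eq_bigr (fun t => P' s t * U' t)); last first.
    by move=> t; rewrite !inE => /andP[/negbTE->].
  case: eqVneq => [->|sx]; last first.
    by have := U's _ (Yx _ sX sx); rewrite reward_elim -/ux; lra.
  have : ux * g' = r' x + \sum_(t in Y) P' x t * U' t by rewrite /ux divfK // gt_eqF.
  by rewrite g'E; lra.
(* The induction hypothesis is used with [c ^+ 3]. At x, numerator and denominator cost one more
   factor [c] each, and [3 (3 ^ n - 1) + 2 = 3 ^ n.+1 - 1]. *)
- rewrite Xn; pose k := (3 ^ n).-1; pose K := c ^+ (3 ^ n.+1).-1.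
  have kE : c ^+ 2 * (c ^+ 3) ^+ k = K.
    rewrite -exprM -exprD /K; congr (_ ^+ _).
    by have := expn_gt0 3 n; rewrite expnS /k; lia.
  have K1 : 1 <= K by exact: exprn_ege1.
  have Kk : (c ^+ 3) ^+ k <= K.
    by rewrite -kE ler_peMl ?exprn_ge0 ?exprn_ege1 // ?ltW // exprn_gt0.
  have {}U'U s : s \in Y -> U' s <= (c ^+ 3) ^+ k * U s.
    by move=> sY; have := U'U s sY; rewrite -Yn.
  move=> s sX; case: eqVneq => [->|sx]; last first.
    by rewrite (le_trans (U'U _ (Yx _ sX sx))) // ler_wpM2r.
  apply: (@le_trans _ _ (K * ((r x + \sum_(t in Y) P x t * U t) / g))); last first.
    by rewrite ler_wpM2l // (le_trans ler01).
  rewrite ler_pdivrMr //.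
  have k1 : 1 <= (c ^+ 3) ^+ k by rewrite !exprn_ege1.
  have num : r' x + \sum_(t in Y) P' x t * U' t <=
      c * (c ^+ 3) ^+ k * (r x + \sum_(t in Y) P x t * U t).
    rewrite mulrDr mulr_sumr; apply: lerD.
      by rewrite (le_trans (r'r x)) // ler_wpM2r // ler_peMr // ltW.
    apply: ler_sum => t tY.
    rewrite mulrACA; apply: ler_pM => //; exact: U'U.
  apply: le_trans num _; rewrite -kE.
  set z := r x + _; have z0 : 0 <= z.
    by rewrite addr_ge0 // sumr_ge0 // => t _; rewrite mulr_ge0.
  have -> : c ^+ 2 * (c ^+ 3) ^+ k * (z / g) * g' =
      c * (c ^+ 3) ^+ k * z * (c * g' / g) by field.
  rewrite ler_peMr //.
    by rewrite !mulr_ge0 // ?exprn_ge0 // ltW.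
  by rewrite ler_pdivlMr // mul1r.
Qed.

End elimination.

(** * Finite distributions and their rounding *)

Lemma weighted_sum_eq0 (R : realFieldType) (I : finType) (w h : I -> R) :
  (forall i, 0 <= w i) -> (forall i, 0 < w i -> 0 <= h i) ->
  \sum_i w i * h i <= 0 -> forall i, 0 < w i -> h i = 0.
Proof.
move=> w0 h0 wh i wi.
have H j : true -> 0 <= w j * h j.
  move=> _; have [wj|] := boolP (0 < w j); first by rewrite mulr_ge0 // h0.
  by rewrite lt_def w0 andbT negbK => /eqP->; rewrite mul0r.
have /eqP : \sum_i w i * h i = 0.
  by apply/eqP; rewrite eq_le wh sumr_ge0 // => j _; exact: H.
rewrite psumr_eq0 // => /allP/(_ i (mem_index_enum i)) /=.
by rewrite mulf_eq0 gt_eqF //= => /eqP.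
Qed.

Section dist_theory.
Variables (R : realType) (I : finType).

Lemma dist_support (p : dist R I) : exists i, 0 < p i.
Proof.
have [//|h] := pselect (exists i, 0 < p i); exfalso.
have := dist_sum1 p; rewrite big1 => [/esym/eqP|i _]; first by rewrite oner_eq0.
apply/eqP; rewrite eq_le dist_ge0 andbT leNgt; apply/negP => pi.
by apply: h; exists i.
Qed.

Lemma dist_eq0 (p : dist R I) i : ~~ (0 < p i) -> p i = 0.
Proof. by rewrite -leNgt => h; apply/eqP; rewrite eq_le dist_ge0 h. Qed.

Lemma sum_pred1 (h : I -> R) i : \sum_(j : I) (j == i)%:R * h j = h i.
Proof.
by rewrite (bigD1 i) //= eqxx mul1r big1 ?addr0 // => j /negbTE->; rewrite mul0r.
Qed.

Definition dist_mix (t : R) (t01 : 0 <= t <= 1) (i j : I) : dist R I.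
Proof.
apply: (@Dist _ _ (fun k : I => (1 - t) * (k == i)%:R + t * (k == j)%:R)).
  by move=> k; case/andP: t01 => t0 t1; apply: addr_ge0; apply: mulr_ge0; rewrite ?subr_ge0 ?ler0n.
rewrite big_split /= -!mulr_sumr.
have e (k : I) : \sum_l (l == k)%:R = 1 :> R.
  by rewrite -[RHS](sum_pred1 (fun=> 1) k); apply: eq_bigr => l _; rewrite mulr1.
by rewrite !e !mulr1 subrK.
Defined.

Lemma dist_mixE t (t01 : 0 <= t <= 1) i j (h : I -> R) :
  \sum_k dist_mix t01 i j k * h k = (1 - t) * h i + t * h j.
Proof.
rewrite -!(sum_pred1 h) !mulr_sumr -big_split /=; apply: eq_bigr => k _.
by ring.
Qed.

Lemma one_in_unit_itv : 0 <= (1 : R) <= 1. Proof. by rewrite ler01 lexx. Qed.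

Definition dirac_dist (i : I) : dist R I := dist_mix one_in_unit_itv i i.

Lemma dirac_distE i (h : I -> R) : \sum_k dirac_dist i k * h k = h i.
Proof. by rewrite dist_mixE subrr mul0r mul1r add0r. Qed.

Lemma dirac_dist0 i k : k != i -> dirac_dist i k = 0.
Proof. by rewrite /= => /negbTE->; rewrite !mulr0 addr0. Qed.

(* If no atom on the mean of x and no pair of atoms around it works, then the
   slopes of the atoms on one side bound those on the other, giving l with
   y - E y + l (x - E x) >= 0 on the support and not identically 0. *)
Lemma two_point_mixture (p : dist R I) (x y : I -> R) (k : I) : 0 < p k ->
  exists i j t, [/\ 0 < p i, 0 < p j, 0 <= t <= 1 &
    [/\ x i <= x j, \sum_l p l * x l <= (1 - t) * x i + t * x j,
        (1 - t) * y i + t * y j <= \sum_l p l * y l &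
        \sum_l p l * x l < x j \/ j = k]].
Proof.
move=> pk; set mx := \sum_l p l * x l; set my := \sum_l p l * y l.
pose a i := x i - mx; pose b i := y i - my.
have sumD (h : I -> R) m : \sum_l p l * h l = m -> \sum_l p l * (h l - m) = 0.
  move=> hm; under eq_bigr do rewrite mulrBr.
  by rewrite sumrB hm -mulr_suml dist_sum1 mul1r subrr.
have sa : \sum_l p l * a l = 0 by exact: sumD.
have sb : \sum_l p l * b l = 0 by exact: sumD.
have vanish (h : I -> R) : (forall l, 0 < p l -> 0 <= h l) -> \sum_l p l * h l = 0 ->
    forall l, 0 < p l -> h l = 0.
  move=> h0 hs; apply: weighted_sum_eq0 => //; last by rewrite hs.
  exact: dist_ge0.
have vanishN (h : I -> R) : (forall l, 0 < p l -> h l <= 0) -> \sum_l p l * h l = 0 ->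
    forall l, 0 < p l -> h l = 0.
  move=> h0 hs l pl; apply/eqP; rewrite -oppr_eq0; apply/eqP.
  apply: (vanish (fun l => - h l)) => // [i pi|]; first by rewrite oppr_ge0 h0.
  by under eq_bigr do rewrite mulrN; rewrite sumrN hs oppr0.
(* An atom on the mean of [x] and no worse for [y] gets the whole mass. Its partner, of weight 0, is
   an atom above the mean, or [k] if there is none; in that case [k] lies on the mean too. *)
have [[i [pi ai bi]]|noZ] := pselect (exists i, [/\ 0 < p i, a i = 0 & b i <= 0]).
  have [[j [pj aj]]|noP] := pselect (exists j, 0 < p j /\ 0 < a j).
    exists i, j, 0; rewrite pi pj lexx ler01; split=> //.
    move: ai aj bi; rewrite /a /b => ai aj bi; split; [lra|lra|lra|].
    by left; lra.
  have ak : a k = 0.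
    apply: (vanishN a) => // l pl; rewrite leNgt; apply/negP => al.
    by apply: noP; exists l.
  exists i, k, 0; rewrite pi pk lexx ler01; split=> //.
  move: ai ak bi; rewrite /a /b => ai ak bi; split; [lra|lra|lra|].
  by right.
have [[i [j [pi pj ai aj hij]]]|noNP] := pselect (exists i j,
    [/\ 0 < p i, 0 < p j, a i < 0, 0 < a j & a j * b i - a i * b j <= 0]).
  (* The weight for which the mixture has exactly the mean of [x]. *)
  exists i, j, (- a i / (a j - a i)).
  have d0 : 0 < a j - a i by lra.
  have t1E : 1 - - a i / (a j - a i) = a j / (a j - a i) by field; lra.
  split=> //.
    by rewrite divr_ge0 ?ler_pdivrMr //; lra.
  have E (h : I -> R) : a j / (a j - a i) * h i + - a i / (a j - a i) * h j =
      (a j * h i - a i * h j) / (a j - a i) by field; lra.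
  rewrite t1E !E; split.
  - by move: ai aj; rewrite /a; lra.
  - rewrite ler_pdivlMr // /a; lra.
  - rewrite ler_pdivrMr //; move: hij; rewrite /b; lra.
  - by left; move: aj; rewrite /a; lra.
exfalso.
have bZ l : 0 < p l -> a l = 0 -> 0 < b l.
  by move=> pl al; rewrite ltNge; apply/negP => bl; apply: noZ; exists l.
have [[i0 /andP[pi0 ai0]]|noN] :=
    pselect (exists i, (0 < p i) && (a i < 0)); last first.
  have aZ : forall l, 0 < p l -> a l = 0.
    apply: vanish => // l pl; rewrite leNgt; apply/negP => al.
    by apply: noN; exists l; rewrite pl.
  have bk := bZ k pk (aZ k pk).
  have := vanish b (fun l pl => ltW (bZ l pl (aZ l pl))) sb k pk.
  by move=> bk0; rewrite bk0 ltxx in bk.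
(* The least slope [m] over the atoms below the mean is the multiplier: [b + m a] is nonnegative
   below the mean by minimality, above it because no pair works, and on it by [bZ]. Its mean is 0,
   so it vanishes at some [j] above the mean, and then [i], [j] is a good pair after all. *)
have [i /andP[pi ai] imin] :
    exists2 i, (0 < p i) && (a i < 0) &
    forall l, 0 < p l -> a l < 0 -> b i / - a i <= b l / - a l.
  case: (@Order.TotalTheory.arg_minP _ _ _ i0 (fun i => (0 < p i) && (a i < 0))
    (fun i => b i / - a i)); first by rewrite pi0.
  by move=> i hi H; exists i => // l pl al; apply: H; rewrite pl.
pose m := b i / - a i.
have hm l : 0 < p l -> 0 <= b l + m * a l.
  move=> pl; case: (ltgtP (a l) 0) => al.
  - have := imin l pl al; rewrite -/m => /(ler_wpM2r (_ : 0 <= - a l)).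
    rewrite divfK; last by lra.
    by move=> /(_ _); lra.
  - have [//|bl] := leP 0 (b l + m * a l); exfalso; apply: noNP; exists i, l; split=> //.
    have E : a l * b i - a i * b l = - a i * (b l + m * a l).
      by rewrite /m; field; lra.
    by rewrite E; nra.
  - by rewrite al mulr0 addr0 ltW // bZ.
have hs : \sum_l p l * (b l + m * a l) = 0.
  under eq_bigr do rewrite mulrDr mulrCA.
  by rewrite big_split /= -mulr_sumr sa sb mulr0 addr0.
have [j [pj aj]] : exists j, 0 < p j /\ 0 < a j.
  have [//|noP] := pselect (exists j, 0 < p j /\ 0 < a j); exfalso.
  have : a i = 0.
    apply: (vanishN a) => // l pl; rewrite leNgt; apply/negP => al.
    by apply: noP; exists l.
  by lra.
have bj : b j + m * a j = 0 := vanish _ hm hs j pj.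
apply: noNP; exists i, j; split=> //.
have -> : a j * b i - a i * b j = - a i * (b j + m * a j) by rewrite /m; field; lra.
by rewrite bj mulr0.
Qed.

(** In the mixture of two atoms, the weight of the one with the larger [x] is rounded up to a
    multiple of 1/M. The mean of [x] can only grow, and at most 1/M of the mass moves, at a price of
    at most [K] per unit. *)
Lemma two_point_rounding (p : dist R I) (x y : I -> R) (K : R) (k : I) (M : nat) :
  0 < p k -> (0 < M)%N -> (forall i j, 0 < p i -> 0 < p j -> y j - y i <= K) ->
  exists p' : dist R I, [/\ forall i, exists z : int, p' i = z%:~R / M%:R,
    forall i, 0 < p' i -> 0 < p i,
    \sum_i p i * x i <= \sum_i p' i * x i,
    \sum_i p' i * y i <= \sum_i p i * y i + K / M%:R &
    (exists i, 0 < p' i /\ \sum_i p i * x i < x i) \/ 0 < p' k].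
Proof.
move=> pk M0 yK.
have [i [j [t [pi pj /andP[t0 t1] [xij xm ym jk]]]]] := two_point_mixture x y pk.
have MR : 0 < M%:R :> R by rewrite ltr0n.
(* At least one unit, so that [j] is in the support of the result even when [t = 0]. *)
pose z := Num.max 1 (Num.ceil (t * M%:R)).
have zt : t * M%:R <= z%:~R.
  by apply: le_trans (ceil_ge _) _; rewrite ler_int le_max lexx orbT.
have z1 : 1 <= z%:~R :> R by rewrite ler1z le_max lexx.
have zM : z%:~R <= M%:R :> R.
  rewrite (pmulrn 1 M) ler_int ge_max; apply/andP; split; first by lia.
  by rewrite ceil_le_int ?ler_piMl // ltW.
have zt1 : z%:~R <= t * M%:R + 1.
  have h0 : 0 <= t * M%:R by rewrite mulr_ge0 // ltW.
  rewrite /z; case: (leP 1 (Num.ceil (t * M%:R))) => _; last by lra.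
  by have := ceilB1_lt (t * M%:R); rewrite intrB; lra.
pose s := z%:~R / M%:R : R.
have sM : s * M%:R = z%:~R by rewrite divfK // gt_eqF.
have s01 : 0 <= s <= 1.
  by rewrite ler_pdivrMr // mul1r zM andbT divr_ge0 // ?ltW //; lra.
have s0 : 0 < s by rewrite divr_gt0 //; lra.
have ts : t <= s by rewrite ler_pdivlMr.
have st : s <= t + M%:R^-1.
  by rewrite ler_pdivrMr // mulrDl mulVf ?gt_eqF.
exists (dist_mix s01 i j).
have pj' : 0 < dist_mix s01 i j j.
  have /andP[_ s1] := s01; rewrite /= eqxx mulr1 ltr_wpDl // mulr_ge0 //.
  by rewrite subr_ge0.
split.
- move=> l; exists ((M%:Z - z) * (l == i)%:R + z * (l == j)%:R).
  rewrite /= !(intrD, intrM, intrN) -/s /s /=.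
  by do 2![case: eqP => _] => /=; field; rewrite gt_eqF.
- move=> l; have [->//|li] := eqVneq l i; have [->//|lj] := eqVneq l j.
  by rewrite /= (negbTE li) (negbTE lj) !mulr0 addr0 ltxx.
- rewrite dist_mixE; apply: le_trans xm _; nra.
- rewrite dist_mixE.
  have : (s - t) * (y j - y i) <= K / M%:R.
    have [yy|yy] := leP 0 (y j - y i).
      by rewrite mulrC ler_pM ?yK //; lra.
    have K0 : 0 <= K by have := yK i i pi pi; rewrite subrr.
    apply: (@le_trans _ _ 0); first by nra.
    by rewrite divr_ge0 // ltW.
  by lra.
- by case: jk => [h|<-]; [left; exists j | right].
Qed.

(** The atom of the support with the largest [x] collects what the others lose by rounding down, so
    the mean of [x] does not drop. For large M the total loss is a small fraction of each positive
    weight. *)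
Lemma floor_rounding (p : dist R I) (x : I -> R) (c : R) : 1 < c ->
  exists N, forall M, (N <= M)%N -> (0 < M)%N ->
  exists p' : dist R I, [/\ forall i, exists z : int, p' i = z%:~R / M%:R,
    forall i, p' i <= c * p i, forall i, p i <= c * p' i &
    \sum_i p i * x i <= \sum_i p' i * x i].
Proof.
move=> c1; have [i0 pi0] := dist_support p.
have [i pi imax] : exists2 i, 0 < p i & forall l, 0 < p l -> x l <= x i.
  case: (@Order.TotalTheory.arg_maxP _ _ _ i0 (fun i => 0 < p i) x) => // i.
  by exists i.
pose d := 1 - c^-1.
have cV : c * c^-1 = 1 by rewrite divff //; lra.
have d0 : 0 < d by rewrite subr_gt0 invf_lt1 //; lra.
pose n := #|I|%:R : R.
have n1 : 1 <= n by rewrite ler1n; apply/card_gt0P; exists i0.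
(* [B] dominates each of its terms, so [B <= M] makes the total rounding error [n / M] at most
   [p l * d] for every atom of the support. *)
pose B := \sum_(l | 0 < p l) n / (p l * d).
have B0 : 0 <= B.
  by rewrite sumr_ge0 // => l pl; rewrite divr_ge0 ?mulr_ge0 //; lra.
exists (Num.bound B) => M NM M0.
have MR : 0 < M%:R :> R by rewrite ltr0n.
have hM l : 0 < p l -> n / M%:R <= p l * d.
  move=> pl; rewrite ler_pdivrMr // mulrC -ler_pdivrMr ?mulr_gt0 //.
  apply: (@le_trans _ _ B).
    rewrite /B (bigD1 l) //= lerDl sumr_ge0 // => k /andP[pk _].
    by rewrite divr_ge0 ?mulr_ge0 //; lra.
  by apply/ltW/(lt_le_trans (archi_boundP B0)); rewrite ler_nat.
pose fl l : R := (Num.floor (p l * M%:R))%:~R / M%:R.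
have fl_le l : fl l <= p l by rewrite ler_pdivrMr // floor_le.
have fl_gt l : p l <= fl l + M%:R^-1.
  rewrite -[_^-1]mul1r -mulrDl ler_pdivlMr //.
  by have := ltW (floorD1_gt (p l * M%:R)); rewrite intrD.
have fl0 l : 0 <= fl l.
  by rewrite divr_ge0 ?(ltW MR) // ler0z floor_ge0 mulr_ge0 ?dist_ge0 // ltW.
have fl_c l : p l <= c * fl l.
  have [pl|/dist_eq0->] := boolP (0 < p l); last by rewrite mulr_ge0 //; lra.
  have h1 := hM l pl; have h2 := fl_gt l.
  have h3 : M%:R^-1 <= n / M%:R by rewrite ler_peMl // invr_ge0 ltW.
  have : p l * c^-1 <= fl l.
    by rewrite /d mulrBr mulr1 in h1; lra.
  by move=> /(ler_wpM2l (_ : 0 <= c)); rewrite mulrCA cV mulr1; apply; lra.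
pose q l : R := if l == i then 1 - \sum_(k | k != i) fl k else fl l.
have pi_eq : p i = 1 - \sum_(k | k != i) p k.
  by rewrite -(dist_sum1 p) (bigD1 i) //=; ring.
have qp : p i <= q i.
  by rewrite /q eqxx pi_eq lerD2l lerN2 ler_sum.
have q0 l : 0 <= q l.
  have [->|li] := eqVneq l i; first exact: le_trans (ltW pi) qp.
  by rewrite /q (negbTE li).
have q1 : \sum_l q l = 1.
  rewrite (bigD1 i) //= {1}/q eqxx (eq_bigr fl) ?subrK // => l /negbTE li.
  by rewrite /q li.
exists (Dist q0 q1); split=> /=.
- move=> l; rewrite /q; case: ifP => _; last by eexists.
  exists (M%:Z - \sum_(k | k != i) Num.floor (p k * M%:R)).
  rewrite intrB -pmulrn mulrBl divff ?gt_eqF //; congr (1 - _).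
  by rewrite /fl -mulr_suml -rmorph_sum.
- move=> l; have [->|li] := eqVneq l i; last first.
    rewrite /q (negbTE li) (le_trans (fl_le l)) // ler_peMl ?dist_ge0 //.
    exact: ltW.
  have h : q i <= p i + n / M%:R.
    rewrite /q eqxx pi_eq -addrA lerD2l.
    have : \sum_(k | k != i) p k <= \sum_(k | k != i) fl k + \sum_(k | k != i) M%:R^-1.
      by rewrite -big_split ler_sum.
    have : \sum_(k | k != i) M%:R^-1 <= n / M%:R.
      rewrite /n mulr_natl -sumr_const [leRHS](bigD1 i) //= lerDr.
      by rewrite invr_ge0 ltW.
    by lra.
  (* Here [1 + d = 2 - c^-1] is at most [c]. *)
  apply: (le_trans h); have := hM i pi; rewrite /d; nra.
- move=> l; have [->|li] := eqVneq l i; last by rewrite /q (negbTE li).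
  by apply: le_trans qp _; rewrite ler_peMl // ltW.
- rewrite (bigD1 i) //= [leRHS](bigD1 i) //= {1}/q eqxx {1}pi_eq.
  rewrite [X in _ <= _ + X](eq_bigr (fun l => fl l * x l)); last first.
    by move=> l /negbTE li; rewrite /q li.
  have : 0 <= \sum_(l | l != i) (p l - fl l) * (x i - x l).
    apply: sumr_ge0 => l li.
    have [pl|/dist_eq0 pl] := boolP (0 < p l).
      by rewrite mulr_ge0 // subr_ge0 // imax.
    by rewrite /fl pl mul0r floor0 mul0r subr0 mul0r.
  rewrite (eq_bigr (fun l => p l * x i - fl l * x i - p l * x l + fl l * x l)); last first.
    by move=> l _; ring.
  rewrite !big_split /= !sumrN -!mulr_suml; lra.
Qed.

End dist_theory.

(** * Integrals of coordinate functions on path space *)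

Section word_integral.
Variables (R : realType) (X : finType) (x0 : X).
Variables (P : probability (infseq_meas x0) R) (p : seq X -> R).
Hypothesis P_cylinder : forall w, P (cylinder w) = (p w)%:E.

Lemma measurable_cylinder w : measurable (cylinder w : set (infseq_meas x0)).
Proof. by apply: sub_sigma_algebra; exists w. Qed.

Let term (h : X -> R) j (w : (j.+1).-tuple X) (x : infseq_meas x0) : \bar R :=
  ((h (last x0 w))%:E * (\1_(cylinder w : set (infseq_meas x0)) x)%:E)%E.

(** The letter at position [j] is read off the prefix of length [j + 1], so a function of it is a
    finite combination of cylinder indicators, whose integrals are known. *)
Let coordinateE (h : X -> R) j (x : infseq_meas x0) :
  (h (x j))%:E = (\sum_(w : (j.+1).-tuple X) term h w x)%E.
Proof.
have lastE : last x0 (mkseq x j.+1) = x j.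
  by rewrite -nth_last size_mkseq nth_mkseq.
rewrite (bigD1 [tuple of mkseq x j.+1]) //= big1 => [|w wx].
  rewrite adde0 /term indicE mem_set; last first.
    by change (mkseq x (size (mkseq x j.+1)) = mkseq x j.+1); rewrite size_mkseq.
  by rewrite mule1 -[in LHS]lastE.
rewrite /term indicE memNset ?mule0 //= /cylinder /= size_tuple => wE.
by move/eqP: wx; apply; apply: val_inj.
Qed.

Let term_ge0 (h : X -> R) j (w : (j.+1).-tuple X) x :
  (forall y, 0 <= h y) -> (0 <= term h w x)%E.
Proof. by move=> h0; rewrite mule_ge0 // lee_fin. Qed.

Let measurable_term (h : X -> R) j (w : (j.+1).-tuple X) :
  measurable_fun setT (term h w).
Proof.
apply: measurable_funeM; apply/measurable_EFinP.
exact: (@measurable_indic _ (infseq_meas x0) R setT _ (measurable_cylinder w)).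
Qed.

Lemma measurable_coordinate (h : X -> R) j :
  measurable_fun setT (fun x : infseq_meas x0 => (h (x j))%:E).
Proof.
rewrite (_ : (fun x => _) = (fun x => \sum_(w : (j.+1).-tuple X) term h w x)%E);
  last by apply/funext => x; exact: coordinateE.
by apply: emeasurable_sum => w; exact: measurable_term.
Qed.

Lemma integral_coordinate (h : X -> R) j : (forall y, 0 <= h y) ->
  (\int[P]_x (h (x j))%:E)%E =
  (\sum_(w : (j.+1).-tuple X) p w * h (last x0 w))%:E.
Proof.
move=> h0; under eq_integral do rewrite (coordinateE h).
rewrite ge0_integral_sum //; last first.
  by move=> w x _; exact: term_ge0.
rewrite -sumEFin; apply: eq_bigr => w _.
rewrite ge0_integralZl_EFin //; last first.
- apply/measurable_EFinP.
  exact: (@measurable_indic _ (infseq_meas x0) R setT _ (measurable_cylinder w)).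
rewrite integral_indic //; last exact: measurable_cylinder.
rewrite setIT mulrC EFinM; congr (_ * _)%E; exact: P_cylinder.
Qed.

Lemma integral_series (h : X -> R) : (forall y, 0 <= h y) ->
  (\int[P]_x \sum_(0 <= j <oo) (h (x j))%:E =
  \sum_(0 <= j <oo) (\sum_(w : (j.+1).-tuple X) p w * h (last x0 w))%:E)%E.
Proof.
move=> h0; rewrite integral_nneseries //.
- by apply: eq_eseriesr => j _; exact: integral_coordinate.
- by move=> j; exact: measurable_coordinate.
- by move=> j x _; rewrite lee_fin.
Qed.

End word_integral.

Lemma big_tuple_cons (R : nmodType) (X : finType) n (F : n.+1.-tuple X -> R) :
  \sum_w F w = \sum_(x : X) \sum_(w : n.-tuple X) F [tuple of x :: w].
Proof.
rewrite pair_bigA /= (reindex (fun q : X * n.-tuple X => [tuple of q.1 :: q.2])) //=.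
exists (fun w => (thead w, [tuple of behead w])) => [[x w] _ | w _] /=.
  by congr pair; apply: val_inj.
by rewrite [RHS]tuple_eta.
Qed.

Lemma cvg_finite_sum (R : realType) (I : finType) (D : pred I)
    (f : I -> nat -> R) (l : I -> R) :
  (forall i, D i -> f i n @[n --> \oo] --> l i) ->
  (\sum_(i | D i) f i n) @[n --> \oo] --> \sum_(i | D i) l i.
Proof. by move=> fl; apply: cvg_big => //; exact: add_continuous. Qed.

(** * Expected total reward as a limit of value iteration *)

Section chain.
Variables (R : realType) (Sd Sb A : finType) (G : game Sd Sb A).
Local Notation state := (Sd + Sb)%type.

Definition qval (rho : state -> A -> R) (U : state -> R) (s : state) (a : A) : R :=
  rho s a + \sum_t trans R G s a t * U t.

Lemma qval_le rho U W s a : (forall t, U t <= W t) -> qval rho U s a <= qval rho W s a.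
Proof.
by move=> UW; rewrite lerD2l ler_sum // => t _; rewrite ler_wpM2l // trans_ge0.
Qed.

Lemma qval_ge0 rho U s a : (forall s a, 0 <= rho s a) -> (forall t, 0 <= U t) ->
  0 <= qval rho U s a.
Proof.
by move=> r0 U0; rewrite addr_ge0 // sumr_ge0 // => t _; rewrite mulr_ge0 // trans_ge0.
Qed.

Lemma qvalD rho U k s a : enabled G s a ->
  qval rho (fun t => U t + k) s a = qval rho U s a + k.
Proof.
move=> en; rewrite /qval -addrA; congr (_ + _).
under eq_bigr do rewrite mulrDr.
by rewrite big_split /= -mulr_suml trans_sum1 // mul1r.
Qed.

Variables (sigma : ctrl_strategy R G) (pi : env_strategy R G).
Variable rho : state -> A -> R.
Hypothesis rho_ge0 : forall s a, 0 <= rho s a.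

Definition step (U : state -> R) (s : state) : R :=
  \sum_a act sigma pi s a * qval rho U s a.

Definition value_iter (n : nat) : state -> R := iter n step (fun=> 0).

Lemma step_le U W : (forall t, U t <= W t) -> forall s, step U s <= step W s.
Proof.
by move=> UW s; apply: ler_sum => a _; rewrite ler_wpM2l ?dist_ge0 ?qval_le.
Qed.

Lemma step_ge0 U : (forall t, 0 <= U t) -> forall s, 0 <= step U s.
Proof.
move=> U0 s; apply: sumr_ge0 => a _; rewrite mulr_ge0 ?dist_ge0 //.
exact: qval_ge0.
Qed.

Lemma value_iter_ge0 n s : 0 <= value_iter n s.
Proof. by elim: n s => [|n IH] s //=; exact: step_ge0. Qed.

Lemma value_iter_step n s : value_iter n s <= value_iter n.+1 s.
Proof.
elim: n s => [|n IH] s; first exact: (value_iter_ge0 1).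
exact: step_le.
Qed.

Lemma value_iter_le_super U : (forall s, 0 <= U s) -> (forall s, step U s <= U s) ->
  forall n s, value_iter n s <= U s.
Proof.
move=> U0 sU; elim=> [|n IH] s //=.
by apply: le_trans (sU s); exact: step_le.
Qed.

(** Expected reward at step [j] from the initial law [mu]. The words are nonempty, so [x1] is a mere
    default for [last]. *)
Let layer (j : nat) (mu : state -> R) (x1 : state * A) : R :=
  \sum_(w : (j.+1).-tuple (state * A))
    word_prob sigma pi mu w * rho (last x1 w).1 (last x1 w).2.

Let layer0 mu x1 :
  layer 0 mu x1 = \sum_t \sum_a mu t * act sigma pi t a * rho t a.
Proof.
rewrite /layer big_tuple_cons [RHS]pair_bigA /=; apply: eq_bigr => -[t a] _.
rewrite (big_pred1 [tuple]) => [|w]; last by apply/esym/eqP; exact: tuple0.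
by rewrite /= mulr1.
Qed.

Let layerS j mu x1 : layer j.+1 mu x1 =
  \sum_t \sum_a mu t * act sigma pi t a * layer j (trans R G t a) x1.
Proof.
rewrite /layer big_tuple_cons [RHS]pair_bigA /=; apply: eq_bigr => -[t a] _.
rewrite mulr_sumr; apply: eq_bigr => w _ /=; rewrite -!mulrA; congr (_ * (_ * (_ * _))).
by case/tupleP: w.
Qed.

Let sum_layers n mu x1 :
  \sum_(0 <= j < n) layer j mu x1 = \sum_t mu t * value_iter n t.
Proof.
elim: n mu => [|n IH] mu.
  by rewrite big_geq // big1 // => t _; rewrite mulr0.
rewrite big_nat_recl // layer0; under eq_bigr do rewrite layerS.
rewrite [X in _ + X]exchange_big /= -big_split /=; apply: eq_bigr => t _.
rewrite [X in _ + X]exchange_big /= -big_split /= mulr_sumr; apply: eq_bigr => a _.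
by rewrite -mulr_sumr IH -mulrDr -mulrA.
Qed.

(** Replaces the path integral by finite sums: monotone convergence exchanges integral and series,
    and a first-step decomposition identifies the partial sums with the value iterates. *)
Lemma expected_leP s k :
  (expected sigma pi s rho <= k%:E)%E <-> forall n, value_iter n s <= k.
Proof.
rewrite /expected.
have -> := @integral_series R _ (path_point sigma pi s) (path_measure sigma pi s)
  (word_prob sigma pi (start R s)) _ (fun x => rho x.1 x.2); last 2 first.
  by move=> w; rewrite /path_measure; case: cid.
  by move=> x.
have sumE n : (\sum_(0 <= j < n) (\sum_(w : (j.+1).-tuple (state * A))
    word_prob sigma pi (start R s) w * rho (last (path_point sigma pi s) w).1
      (last (path_point sigma pi s) w).2)%:E = (value_iter n s)%:E)%E.
  rewrite sumEFin (sum_layers n (start R s) (path_point sigma pi s)).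
  by congr EFin; exact: sum_pred1.
have layer_ge0 j : (0 <= (\sum_(w : (j.+1).-tuple (state * A))
    word_prob sigma pi (start R s) w * rho (last (path_point sigma pi s) w).1
      (last (path_point sigma pi s) w).2)%:E)%E.
  rewrite lee_fin; apply: sumr_ge0 => w _; apply: mulr_ge0 => //.
  by apply: word_prob_ge0 => t; exact: ler0n.
split=> [h n|h].
  rewrite -lee_fin -sumE; apply: le_trans h.
  by apply: nneseries_lim_ge => j _ _.
apply: lime_le; first by apply: is_cvg_nneseries => j _ _.
by apply: nearW => n /=; rewrite sumE lee_fin.
Qed.

Lemma expected_ge0 s : (0 <= expected sigma pi s rho)%E.
Proof.
by apply: integral_ge0 => x _; apply: nneseries_ge0 => j _ _; rewrite lee_fin.
Qed.

(** An infinite expectation is sent to 0, hence the finiteness hypothesis in the section that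
    follows. *)
Definition total (s : state) : R := fine (expected sigma pi s rho).

Lemma total_ge0 s : 0 <= total s.
Proof. exact/fine_ge0/expected_ge0. Qed.

Section finite_expectation.
Variable s : state.
Hypothesis fin : (expected sigma pi s rho < +oo)%E.

Lemma totalE : expected sigma pi s rho = (total s)%:E.
Proof. by rewrite fineK // ge0_fin_numE // expected_ge0. Qed.

Lemma value_iter_le_total n : value_iter n s <= total s.
Proof. by apply: (expected_leP s (total s)).1; rewrite totalE. Qed.

Lemma total_le k : (forall n, value_iter n s <= k) -> total s <= k.
Proof. by move/(expected_leP s k).2; rewrite totalE lee_fin. Qed.

Lemma value_iter_cvg : value_iter n s @[n --> \oo] --> total s.
Proof.
have nd : nondecreasing_seq (value_iter ^~ s).
  by apply/nondecreasing_seqP => n; exact: value_iter_step.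
have ub : has_ubound (range (value_iter ^~ s)).
  by exists (total s) => _ [n _ <-]; exact: value_iter_le_total.
have := nondecreasing_cvgn nd ub.
suff -> : sup (range (value_iter ^~ s)) = total s by [].
apply/eqP; rewrite eq_le; apply/andP; split.
  apply: ge_sup; first by exists (value_iter 0 s), 0%N.
  by move=> _ [n _ <-]; exact: value_iter_le_total.
by apply: total_le => n; apply: ub_le_sup => //; exists n.
Qed.

End finite_expectation.

(** The recursion of the value iterates passed to the limit. The sum is cut down to states of finite
    expectation because penalties, unlike rewards, may have infinite expectation at some states. *)
Lemma total_super (C : {set state}) s :
  (forall t, t \in C -> (expected sigma pi t rho < +oo)%E) -> s \in C ->
  \sum_a act sigma pi s a *
    (rho s a + \sum_(t in C) trans R G s a t * total t) <= total s.
Proof.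
move=> Cfin sC.
have cv : (\sum_a act sigma pi s a *
    (rho s a + \sum_(t in C) trans R G s a t * value_iter n t)) @[n --> \oo] -->
    \sum_a act sigma pi s a *
    (rho s a + \sum_(t in C) trans R G s a t * total t).
  apply: cvg_finite_sum => a _; apply: cvgMl_tmp; apply: cvgD; first exact: cvg_cst.
  apply: cvg_finite_sum => t tC; apply: cvgMl_tmp; apply: value_iter_cvg.
  exact: Cfin.
rewrite -(cvg_lim (@norm_hausdorff _ _) cv).
apply: limr_le; first by apply/cvg_ex; eexists; exact: cv.
apply: nearW => n; apply: le_trans (value_iter_le_total (Cfin s sC) n.+1) => /=.
apply: ler_sum => a _; rewrite ler_wpM2l ?dist_ge0 // lerD2l.
rewrite [leRHS](bigID (mem C)) /= lerDl sumr_ge0 // => t _.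
by rewrite mulr_ge0 ?trans_ge0 ?value_iter_ge0.
Qed.

(** A successor reached with probability at least [z] contributes at least [z] times its own
    expectation. *)
Lemma total_closed (C : {set state}) s a t :
  C = [set t | (expected sigma pi t rho < +oo)%E]%SET ->
  s \in C -> 0 < act sigma pi s a -> 0 < trans R G s a t -> t \in C.
Proof.
move=> CE sC as0 at0; move: sC; rewrite CE !inE => sfin.
pose z := act sigma pi s a * trans R G s a t; have z0 : 0 < z by rewrite mulr_gt0.
suff : (expected sigma pi t rho <= (total s / z)%:E)%E.
  by move=> h; exact: le_lt_trans h (ltry _).
apply/expected_leP => n; rewrite ler_pdivlMr //.
apply: le_trans (value_iter_le_total sfin n.+1) => /=.
rewrite /step (bigD1 a) //= ler_wpDr //.
  apply: sumr_ge0 => b _; rewrite mulr_ge0 ?dist_ge0 // qval_ge0 // => u.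
  exact: value_iter_ge0.
rewrite /z mulrC -mulrA ler_wpM2l ?dist_ge0 // /qval (bigD1 t) //=.
rewrite addrCA lerDl addr_ge0 // sumr_ge0 // => u _.
by rewrite mulr_ge0 ?trans_ge0 ?value_iter_ge0.
Qed.

End chain.

(** * Set minima, and strategies complying with a multi-strategy *)

Section vmin_theory.
Variables (R : realType) (T : finType).
Implicit Types (h : T -> R) (B : {set T}).

Lemma vmin_mono h h' B : (forall a, a \in B -> h a <= h' a) -> vmin h B <= vmin h' B.
Proof.
move=> hh; have [->|/(vmin_attained h')[a aB <-]] := eqVneq B finset.set0.
  by rewrite /vmin; case: pickP => // x; rewrite inE.
exact: le_trans (vmin_le h aB) (hh a aB).
Qed.

Lemma vmin_ge0 h B : (forall a, 0 <= h a) -> 0 <= vmin h B.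
Proof. by move=> h0; rewrite /vmin; case: pickP. Qed.

Lemma vmin_le_mean h B (p : dist R T) : (forall a, a \notin B -> p a = 0) ->
  vmin h B <= \sum_a p a * h a.
Proof.
move=> pB; rewrite -[leLHS]mul1r -(dist_sum1 p) mulr_suml; apply: ler_sum => a _.
have [aB|/pB->] := boolP (a \in B); last by rewrite !mul0r.
by rewrite ler_wpM2l ?dist_ge0 // vmin_le.
Qed.

End vmin_theory.

Section compliance.
Variables (R : realType) (Sd Sb A : finType) (G : game Sd Sb A).
Local Notation state := (Sd + Sb)%type.
Local Notation ms := (multistrategy R G).

Lemma ms_support (theta : ms) x B : 0 < theta x B ->
  B != finset.set0 /\ B \subset enabled G (inl x).
Proof.
move=> tB; split; first by apply: contraTneq tB => ->; rewrite ms_nonempty ltxx.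
by apply: contraLR tB => /ms_enabled->; rewrite ltxx.
Qed.

Definition selects (d : Sd -> {set A} -> dist R A) : Prop :=
  forall x (B : {set A}), B != finset.set0 -> B \subset enabled G (inl x) ->
  forall a, a \notin B -> d x B a = 0.

(** Sets outside the support have weight 0 and [d] vanishes off its set, so the sum in the
    definition of compliance extends to all sets and all actions. *)
Lemma complies_selection (sigma : ctrl_strategy R G) (theta : ms) :
  complies sigma theta -> exists d, selects d /\
    forall x a, sigma x a = \sum_B theta x B * d x B a.
Proof.
move=> [d [dB sE]]; exists d; split=> // x a.
have [en|dis] := boolP (enabled G (inl x) a).
  rewrite sE // [RHS](bigID (fun B : {set A} => a \in B)) /= [X in _ = _ + X]big1 ?addr0 //.
  move=> B aB; have [tB|/dist_eq0->] := boolP (0 < theta x B); last by rewrite mul0r.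
  by have [B0 Bs] := ms_support tB; rewrite dB ?mulr0.
rewrite strat_enabled // big1 // => B _.
have [tB|/dist_eq0->] := boolP (0 < theta x B); last by rewrite mul0r.
have [B0 Bs] := ms_support tB; rewrite dB ?mulr0 //.
by apply: contra dis => /(fintype.subsetP Bs).
Qed.

Lemma selection_complies (theta : ms) d : selects d ->
  exists2 sigma : ctrl_strategy R G, complies sigma theta &
    forall x a, sigma x a = \sum_B theta x B * d x B a.
Proof.
move=> dB.
pose f x a := \sum_B theta x B * d x B a.
have f0 x a : 0 <= f x a by rewrite sumr_ge0 // => B _; rewrite mulr_ge0 ?dist_ge0.
have f1 x : \sum_a f x a = 1.
  rewrite exchange_big /= -(dist_sum1 (theta x)); apply: eq_bigr => B _.
  by rewrite -mulr_sumr dist_sum1 mulr1.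
have fout x a (B : {set A}) : a \notin B -> theta x B * d x B a = 0.
  move=> aB; have [tB|/dist_eq0->] := boolP (0 < theta x B); last by rewrite mul0r.
  by have [B0 Bs] := ms_support tB; rewrite dB ?mulr0.
have fen x a : ~~ enabled G (inl x) a -> f x a = 0.
  move=> dis; rewrite /f big1 // => B _.
  have [aB|/fout//] := boolP (a \in B).
  by rewrite ms_enabled ?mul0r //; apply: contra dis => /fintype.subsetP/(_ a aB).
exists (@Strategy R Sd Sb A G Sd (@inl Sd Sb) (fun x => Dist (f0 x) (f1 x)) fen) => //.
exists d; split=> // x a _ /=; rewrite /f (bigID (fun B : {set A} => a \in B)) /=.
by rewrite [X in _ + X]big1 ?addr0 // => B; exact: fout.
Qed.

Lemma selection_sum (theta : ms) d (p : dist R A) x (h : A -> R) :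
  (forall a, p a = \sum_B theta x B * d x B a) ->
  \sum_a p a * h a = \sum_B theta x B * \sum_a (d x B a : R) * h a.
Proof.
move=> pE; under eq_bigr do rewrite pE mulr_suml.
rewrite exchange_big /=; apply: eq_bigr => B _; rewrite mulr_sumr.
by apply: eq_bigr => a _; rewrite mulrA.
Qed.

(** The opponent that answers each drawn set by one fixed action. The optimal opponent and the one
    staying in a trap are both of this form. *)
Lemma deterministic_strategies (theta : ms) (f : Sd -> {set A} -> A) (g : Sb -> A) :
  (forall x (B : {set A}), B != finset.set0 -> f x B \in B) ->
  (forall y, enabled G (inr y) (g y)) ->
  exists (sigma : ctrl_strategy R G) (pi : env_strategy R G),
  [/\ complies sigma theta,
    forall x h, \sum_a act sigma pi (inl x) a * h a = \sum_B theta x B * h (f x B) &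
    forall y h, \sum_a act sigma pi (inr y) a * h a = h (g y)].
Proof.
move=> fB gen.
have dB : selects (fun x B => dirac_dist R (f x B)).
  move=> x B B0 _ a aB; apply: dirac_dist0; apply: contraNneq aB => ->.
  exact: fB.
have [sigma sc sE] := selection_complies theta dB.
have pen y a : ~~ enabled G (inr y) a -> dirac_dist R (g y) a = 0.
  by move=> dis; apply: dirac_dist0; apply: contraNneq dis => ->.
exists sigma, (@Strategy R Sd Sb A G Sb (@inr Sd Sb) (fun y => dirac_dist R (g y)) pen).
split=> // [x h|y h]; last exact: (dirac_distE (g y) h).
pose d x B := dirac_dist R (f x B).
apply: etrans (selection_sum (d := d) h (sE x)) _; apply: eq_bigr => B _.
by congr (_ * _); exact: (dirac_distE (f x B) h).
Qed.

Lemma env_enabled (pi : env_strategy R G) y : exists a, enabled G (inr y) a.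
Proof.
have [a pa] := dist_support (pi y); exists a.
by apply: contraLR pa => dis; rewrite (strat_enabled pi) // ltxx.
Qed.

Lemma act_support (sigma : ctrl_strategy R G) (pi : env_strategy R G) s a :
  0 < act sigma pi s a -> enabled G s a.
Proof. by apply: contraLR => /act_enabled->; rewrite ltxx. Qed.

End compliance.

(** * Lower bounds on the total reward by subsolutions *)

Section lower_bound.
Variables (R : realType) (Sd Sb A : finType) (G : game Sd Sb A).
Local Notation state := (Sd + Sb)%type.
Variables (sigma : ctrl_strategy R G) (pi : env_strategy R G).
Variable rho : state -> A -> R.
Hypothesis rho_ge0 : forall s a, 0 <= rho s a.
Hypothesis finE : forall s, (expected sigma pi s rho < +oo)%E.

Let U := total sigma pi rho.

Let U_super s : step sigma pi rho U s <= U s.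
Proof.
have := @total_super R Sd Sb A G sigma pi rho rho_ge0 [set: state]%SET s.
rewrite inE => /(_ (fun t _ => finE t) isT); apply: le_trans.
apply: ler_sum => a _; rewrite ler_wpM2l ?dist_ge0 // lerD2l le_eqVlt.
by apply/orP; left; apply/eqP; apply: eq_bigl => t; rewrite inE.
Qed.

(* Let m be the maximum of V - U, where U is the expected total reward. The set
   where it is attained is closed under the chain, and so is its subset where U
   is minimal; there the reward vanishes, hence so does U, and V = m. *)
Lemma subsolution_le_total (V : state -> R) :
  (forall s, V s <= step sigma pi rho V s) ->
  (forall (C : {set state}) m, C != finset.set0 -> 0 < m ->
    (forall s, s \in C -> V s = m) ->
    (forall s a, s \in C -> 0 < act sigma pi s a ->
       rho s a = 0 /\ forall t, 0 < trans R G s a t -> t \in C) -> False) ->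
  forall s, V s <= U s.
Proof.
move=> Vsub notrap s0; rewrite leNgt; apply/negP => Vs0.
pose D s := V s - U s.
have [s1 _ s1max] := @Order.TotalTheory.arg_maxP _ _ _ s0 xpredT D isT.
have [m Ds1] : exists m, D s1 = m by exists (D s1).
have m0 : 0 < m by rewrite -Ds1; apply: lt_le_trans (s1max s0 isT); rewrite subr_gt0.
have Dm s : D s <= m by rewrite -Ds1; exact: s1max.
(* Maximum principle: [m] is at most the mean of [D] over the successors, where [D <= m]. *)
have closed1 s a t : D s = m -> 0 < act sigma pi s a -> 0 < trans R G s a t ->
    D t = m.
  move=> Ds as0 t0.
  have qD b : 0 < act sigma pi s b -> qval G rho V s b - qval G rho U s b - m =
      - \sum_t trans R G s b t * (m - D t).
    move=> /act_support/trans_sum1 e1.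
    have -> : \sum_t trans R G s b t * (m - D t) =
        m - (\sum_t trans R G s b t * V t - \sum_t trans R G s b t * U t).
      rewrite -[in RHS](mul1r m) -(e1 R) mulr_suml -!sumrB; apply: eq_bigr => u _.
      by rewrite /D; ring.
    by rewrite /qval; ring.
  have zero := weighted_sum_eq0 (w := act sigma pi s)
    (h := fun b => m - (qval G rho V s b - qval G rho U s b)).
  have {zero} : m - (qval G rho V s a - qval G rho U s a) = 0.
    apply: zero => //; first by move=> b; exact: dist_ge0.
      move=> b /qD qb; have : 0 <= \sum_t trans R G s b t * (m - D t).
        by rewrite sumr_ge0 // => u _; rewrite mulr_ge0 ?trans_ge0 // subr_ge0.
      by lra.
    under eq_bigr do rewrite mulrBr [X in _ - X]mulrBr.
    rewrite sumrB sumrB -mulr_suml dist_sum1 mul1r.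
    have := Vsub s; have := U_super s; rewrite /step; move: Ds; rewrite /D; lra.
  move=> qa; have sum0 : \sum_t trans R G s a t * (m - D t) = 0.
    by have := qD a as0; lra.
  suff : m - D t = 0 by lra.
  apply: (weighted_sum_eq0 (w := trans R G s a) (h := fun t => m - D t)) => //.
  - by move=> u; exact: trans_ge0.
  - by move=> u _; rewrite subr_ge0.
  - by rewrite sum0.
have [s2 /eqP s2D s2min] :=
  @Order.TotalTheory.arg_minP _ _ _ s1 (fun s => D s == m) U (introT eqP Ds1).
pose C := [set s | (D s == m) && (U s == U s2)]%SET.
have CP s : s \in C -> D s = m /\ U s = U s2.
  by rewrite inE => /andP[/eqP-> /eqP->].
(* Minimum principle on the set [D = m]: [U s2] is at least the mean of reward plus successor value,
   and no successor value lies below [U s2]. *)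
have closed2 s a : s \in C -> 0 < act sigma pi s a ->
    rho s a = 0 /\ forall t, 0 < trans R G s a t -> t \in C.
  move=> /CP[Ds Us] as0.
  have tmin b t : 0 < act sigma pi s b -> 0 < trans R G s b t -> U s2 <= U t.
    by move=> bs tb; apply: s2min; rewrite (closed1 s b).
  have qE b : 0 < act sigma pi s b -> qval G rho U s b - U s2 =
      rho s b + \sum_t trans R G s b t * (U t - U s2).
    move=> /act_support/trans_sum1 e1; rewrite /qval -addrA; congr (_ + _).
    under [RHS]eq_bigr do rewrite mulrBr.
    by rewrite sumrB -mulr_suml e1 mul1r.
  have term_ge0 b t : 0 < act sigma pi s b -> 0 <= trans R G s b t * (U t - U s2).
    move=> bs; have [t0|] := boolP (0 < trans R G s b t).
      by rewrite mulr_ge0 ?trans_ge0 // subr_ge0 (tmin b).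
    by rewrite lt_def trans_ge0 andbT negbK => /eqP->; rewrite mul0r.
  have q0 : qval G rho U s a - U s2 = 0.
    apply: (weighted_sum_eq0 (w := act sigma pi s)
      (h := fun b => qval G rho U s b - U s2)) => //.
    - by move=> b; exact: dist_ge0.
    - move=> b bs; rewrite qE // addr_ge0 // sumr_ge0 // => t _.
      exact: term_ge0.
    - under eq_bigr do rewrite mulrBr.
      rewrite sumrB -mulr_suml dist_sum1 mul1r subr_le0 -Us.
      exact: U_super.
  have sum0 : 0 <= \sum_t trans R G s a t * (U t - U s2).
    by rewrite sumr_ge0 // => t _; exact: term_ge0.
  have := qE a as0; rewrite q0 => e; have ra := rho_ge0 s a.
  split; first by lra.
  move=> t t0; have Ut : U t - U s2 = 0.
    apply: (weighted_sum_eq0 (w := trans R G s a) (h := fun t => U t - U s2)) => //.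
    - by move=> u; exact: trans_ge0.
    - by move=> u u0; rewrite subr_ge0 (tmin a).
    - by lra.
  rewrite inE (closed1 s a t) // eqxx /=.
  by move/eqP: Ut; rewrite subr_eq0.
have vi0 n s : s \in C -> value_iter sigma pi rho n s = 0.
  elim: n s => // n IH s sC /=; rewrite /step big1 // => a _.
  have [as0|/dist_eq0->] := boolP (0 < act sigma pi s a); last by rewrite mul0r.
  have [ra ta] := closed2 s a sC as0.
  rewrite /qval ra add0r big1 ?mulr0 // => t _.
  have [/ta/IH->|] := boolP (0 < trans R G s a t); first by rewrite mulr0.
  by rewrite lt_def trans_ge0 andbT negbK => /eqP->; rewrite mul0r.
apply: (notrap C m) => //.
- by apply/set0Pn; exists s2; rewrite inE s2D !eqxx.
- move=> s sC; have [Ds _] := CP s sC.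
  have : U s <= 0 by apply: total_le => // n; rewrite vi0.
  have : 0 <= U s by exact: total_ge0.
  by move: Ds; rewrite /D; lra.
Qed.

End lower_bound.

(** * The value guaranteed by a multi-strategy, and traps *)

Section guaranteed_value.
Variables (R : realType) (Sd Sb A : finType) (G : game Sd Sb A).
Local Notation state := (Sd + Sb)%type.
Local Notation ms := (multistrategy R G).
Variable rho : state -> A -> R.
Hypothesis rho_ge0 : forall s a, 0 <= rho s a.

Definition bellman (theta : ms) (U : state -> R) (s : state) : R :=
  match s with
  | inl x => \sum_B theta x B * vmin (qval G rho U (inl x)) B
  | inr y => vmin (qval G rho U (inr y)) [set a | enabled G (inr y) a]%SET
  end.

Lemma bellman_le theta U W : (forall s, U s <= W s) ->
  forall s, bellman theta U s <= bellman theta W s.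
Proof.
move=> UW [x|y] /=; last by apply: vmin_mono => a _; exact: qval_le.
apply: ler_sum => B _; rewrite ler_wpM2l ?dist_ge0 //.
by apply: vmin_mono => a _; exact: qval_le.
Qed.

Lemma bellman_ge0 theta U : (forall s, 0 <= U s) -> forall s, 0 <= bellman theta U s.
Proof.
move=> U0 [x|y] /=; last by apply: vmin_ge0 => a; exact: qval_ge0.
apply: sumr_ge0 => B _; rewrite mulr_ge0 ?dist_ge0 //.
by apply: vmin_ge0 => a; exact: qval_ge0.
Qed.

Lemma bellman_le_step theta sigma (pi : env_strategy R G) U s :
  complies sigma theta -> bellman theta U s <= step sigma pi rho U s.
Proof.
move=> /complies_selection[d [dB sE]]; rewrite /step; case: s => [x|y] /=.
  rewrite (selection_sum (theta := theta) (d := d) (qval G rho U (inl x)) (sE x)).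
  apply: ler_sum => B _.
  have [tB|/dist_eq0->] := boolP (0 < theta x B); last by rewrite !mul0r.
  have [B0 Bs] := ms_support tB.
  by rewrite ler_wpM2l ?dist_ge0 //; apply: vmin_le_mean => a; exact: dB.
apply: vmin_le_mean => a; rewrite inE => dis; exact: strat_enabled.
Qed.

Section fixpoint.
Variables (theta : ms) (sigma0 : ctrl_strategy R G) (pi0 : env_strategy R G).
Hypothesis sigma0_complies : complies sigma0 theta.
Hypothesis fin0 : forall s, (expected sigma0 pi0 s rho < +oo)%E.

Let Vn n := iter n (bellman theta) (fun=> 0).

Let Vn_ge0 n s : 0 <= Vn n s.
Proof. by elim: n s => [|n IH] s //=; exact: bellman_ge0. Qed.

Let Vn_step n s : Vn n s <= Vn n.+1 s.
Proof.
elim: n s => [|n IH] s; first exact: (Vn_ge0 1).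
exact: bellman_le.
Qed.

Let Vn_mono m n s : (m <= n)%N -> Vn m s <= Vn n s.
Proof.
move=> /subnK<-; elim: (n - m)%N => // k IH.
exact: le_trans IH (Vn_step _ _).
Qed.

Let Vn_le_iter sigma pi : complies sigma theta ->
  forall n s, Vn n s <= value_iter sigma pi rho n s.
Proof.
move=> sc; elim=> [|n IH] s //=.
by apply: le_trans (bellman_le _ IH s) _; exact: bellman_le_step.
Qed.

(** The least fixed point of [bellman], reached from 0. The iterates are bounded because the
    compliant pair [sigma0], [pi0] has finite expectation. *)
Definition guaranteed (s : state) : R := sup (range (Vn ^~ s)).
Local Notation V := guaranteed.

Let Vn_sup s : has_sup (range (Vn ^~ s)).
Proof.
split; first by exists (Vn 0 s), 0%N.
exists (total sigma0 pi0 rho s) => _ [n _ <-].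
apply: le_trans (Vn_le_iter pi0 sigma0_complies n s) _.
by apply: value_iter_le_total.
Qed.

Let Vn_le n s : Vn n s <= V s.
Proof. by apply: ub_le_sup; [exact: (Vn_sup s).2 | exists n]. Qed.

Let V_le s k : (forall n, Vn n s <= k) -> V s <= k.
Proof.
by move=> h; apply: ge_sup; [exact: (Vn_sup s).1 | move=> _ [n _ <-]].
Qed.

Lemma guaranteed_ge0 s : 0 <= V s.
Proof. exact: le_trans (Vn_ge0 0 s) (Vn_le 0 s). Qed.

Lemma guaranteed_le_bellman s : V s <= bellman theta V s.
Proof.
apply: V_le => -[|n] /=; first exact/bellman_ge0/guaranteed_ge0.
by apply: bellman_le => t; exact: Vn_le.
Qed.

Lemma guaranteed_le_iter0 sigma pi s : complies sigma theta ->
  (forall n, value_iter sigma pi rho n s = 0) -> V s <= 0.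
Proof.
by move=> sc v0; apply: V_le => n; rewrite -(v0 n); exact: Vn_le_iter.
Qed.

Let bellmanD U k s : 0 <= k -> bellman theta (fun t => U t + k) s <= bellman theta U s + k.
Proof.
move=> k0; have D (t : state) (B : {set A}) :
    B != finset.set0 -> B \subset enabled G t ->
    vmin (qval G rho (fun t => U t + k) t) B <= vmin (qval G rho U t) B + k.
  move=> B0 Be; have [a aB <-] := vmin_attained (qval G rho U t) B0.
  apply: le_trans (vmin_le _ aB) _; rewrite qvalD //.
  by have := fintype.subsetP Be a aB.
case: s => [x|y] /=; last first.
  apply: D; last by apply/fintype.subsetP => a; rewrite inE.
  have [a ea] := env_enabled pi0 y.
  by apply/set0Pn; exists a; rewrite inE.
rewrite -[X in _ <= _ + X]mul1r -(dist_sum1 (theta x)) mulr_suml -big_split /=.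
apply: ler_sum => B _.
have [tB|/dist_eq0->] := boolP (0 < theta x B); last by rewrite !mul0r addr0.
have [B0 Bs] := ms_support tB.
by rewrite -mulrDr ler_wpM2l ?dist_ge0 // D.
Qed.

(** There are finitely many states, so one iterate is within [e] of the supremum at all of them, and
    adding the constant [e] raises [bellman] by at most [e]. *)
Lemma bellman_guaranteed_le s : bellman theta V s <= V s.
Proof.
apply/ler_addgt0Pl => e e0.
have [N hN] : exists N, forall t, V t <= Vn N t + e.
  have : forall t, exists n, V t <= Vn n t + e.
    move=> t; have [_ [n _ <-] hn] := sup_adherent e0 (Vn_sup t).
    by exists n; rewrite -lerBlDr ltW.
  move=> /choice[n hn]; exists (\max_t n t) => t.
  apply: le_trans (hn t) _; rewrite lerD2r; apply: Vn_mono.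
  exact: leq_bigmax.
apply: le_trans (bellman_le _ hN s) _.
apply: le_trans (bellmanD _ _ (ltW e0)) _.
by rewrite addrC lerD2l; exact: (Vn_le N.+1).
Qed.

Lemma set_choice (good : Sd -> {set A} -> A -> Prop) :
  (forall x (B : {set A}), B != finset.set0 -> exists2 a, a \in B & good x B a) ->
  exists f : Sd -> {set A} -> A,
    forall x (B : {set A}), B != finset.set0 -> f x B \in B /\ good x B (f x B).
Proof.
move=> h; have H (p : Sd * {set A}) : exists a, p.2 != finset.set0 ->
    a \in p.2 /\ good p.1 p.2 a.
  have [B0|] := boolP (p.2 != finset.set0).
    by have [a aB ga] := h p.1 p.2 B0; exists a.
  (* The empty set needs some default action; the support of [theta] provides one. *)
  have [B tB] := dist_support (theta p.1).
  by have [/set0Pn[a _] _] := ms_support tB; exists a.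
by have [f hf] := choice H; exists (fun x B => f (x, B)) => x B; exact: (hf (x, B)).
Qed.

(** The opponent choosing a minimising action in each set makes [V] a supersolution of its chain,
    which bounds all value iterates. Applied to a sound [theta], this yields [b <= V] at the initial
    state. *)
Lemma guaranteed_attained : exists sigma (pi : env_strategy R G),
  complies sigma theta /\ forall s, (expected sigma pi s rho <= (V s)%:E)%E.
Proof.
have [f hf] := @set_choice
  (fun x B a => qval G rho V (inl x) a = vmin (qval G rho V (inl x)) B)
  (fun x B B0 => vmin_attained _ B0).
have [g hg] : exists g : Sb -> A, forall y, enabled G (inr y) (g y) /\
    qval G rho V (inr y) (g y) =
    vmin (qval G rho V (inr y)) [set a | enabled G (inr y) a]%SET.
  suff H y : exists a, enabled G (inr y) a /\ qval G rho V (inr y) a =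
      vmin (qval G rho V (inr y)) [set a | enabled G (inr y) a]%SET.
    by have [g hg] := choice H; exists g.
  have [a ea] := env_enabled pi0 y.
  have /(vmin_attained (qval G rho V (inr y)))[c] :
      [set a | enabled G (inr y) a]%SET != finset.set0.
    by apply/set0Pn; exists a; rewrite inE.
  by rewrite inE => ce cE; exists c.
have [sigma [pi [sc sl sr]]] := deterministic_strategies theta
  (fun x B B0 => (hf x B B0).1) (fun y => (hg y).1).
exists sigma, pi; split=> // s0; apply/expected_leP => // n.
suff stepV s : step sigma pi rho V s <= V s.
  by apply: value_iter_le_super => // s; exact: guaranteed_ge0.
apply: le_trans (bellman_guaranteed_le s); case: s => [x|y]; rewrite /step /=.
  rewrite (sl x); apply: ler_sum => B _.
  have [tB|/dist_eq0->] := boolP (0 < theta x B); last by rewrite !mul0r.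
  have [B0 Bs] := ms_support tB.
  by rewrite (hf x B B0).2.
by rewrite (sr y) (hg y).2.
Qed.

Definition stays (C : {set state}) (s : state) (a : A) : Prop :=
  rho s a = 0 /\ forall t, 0 < trans R G s a t -> t \in C.

(** An opponent able to stay in [C] for free against every set of the support would collect no
    reward from there, forcing [V <= 0] on [C]. *)
Lemma no_trap (C : {set state}) : C != finset.set0 ->
  (forall s, s \in C -> 0 < V s) ->
  (forall x B, inl x \in C -> 0 < theta x B -> exists2 a, a \in B & stays C (inl x) a) ->
  (forall y, inr y \in C -> exists2 a, enabled G (inr y) a & stays C (inr y) a) ->
  False.
Proof.
move=> /set0Pn[s0 s0C] Vpos hl hr.
have [f hf] : exists f : Sd -> {set A} -> A,
    forall x (B : {set A}), B != finset.set0 -> f x B \in B /\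
      (inl x \in C -> 0 < theta x B -> stays C (inl x) (f x B)).
  apply: (@set_choice (fun x B a => inl x \in C -> 0 < theta x B -> stays C (inl x) a)).
  move=> x B /set0Pn[a0 a0B].
  have [/andP[xC tB]|no] := boolP ((inl x \in C) && (0 < theta x B)).
    by have [a aB sa] := hl x B xC tB; exists a.
  by exists a0 => // xC tB; case/negP: no; rewrite xC.
have [g hg] : exists g : Sb -> A, forall y, enabled G (inr y) (g y) /\
    (inr y \in C -> stays C (inr y) (g y)).
  suff H y : exists a, enabled G (inr y) a /\ (inr y \in C -> stays C (inr y) a).
    by have [g hg] := choice H; exists g.
  have [/hr[a ea sa]|no] := boolP (inr y \in C); first by exists a.
  by have [a ea] := env_enabled pi0 y; exists a; split.
have [sigma [pi [sc sl sr]]] := deterministic_strategies theta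
  (fun x B B0 => (hf x B B0).1) (fun y => (hg y).1).
have stay0 U s a : (forall s, s \in C -> U s = 0) -> stays C s a -> qval G rho U s a = 0.
  move=> U0 [ra ta]; rewrite /qval ra add0r big1 // => t _.
  have [/ta/U0->|] := boolP (0 < trans R G s a t); first by rewrite mulr0.
  by rewrite lt_def trans_ge0 andbT negbK => /eqP->; rewrite mul0r.
have vi0 n s : s \in C -> value_iter sigma pi rho n s = 0.
  elim: n s => // n IH [x|y] sC; rewrite /= /step.
    rewrite (sl x) big1 // => B _.
    have [tB|/dist_eq0->] := boolP (0 < theta x B); last by rewrite mul0r.
    have [B0 _] := ms_support tB.
    by rewrite (stay0 _ _ _ IH) ?mulr0 //; exact: (hf x B B0).2.
  by rewrite (sr y) (stay0 _ _ _ IH) //; exact: (hg y).2.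
have := guaranteed_le_iter0 sc (fun n => vi0 n s0 s0C).
by rewrite leNgt Vpos.
Qed.

(* Attractor argument: a nonempty set of positive states contains a state where
   the opponent cannot stay inside for free; drop it, after selecting there a set
   B all of whose actions escape. *)
Lemma progress_selection : exists Bst : Sd -> {set A},
  (forall x, 0 < theta x (Bst x)) /\
  forall C : {set state}, C != finset.set0 -> (forall s, s \in C -> 0 < V s) ->
    (forall x, inl x \in C -> exists2 a, a \in Bst x & stays C (inl x) a) ->
    (forall y, inr y \in C -> exists2 a, enabled G (inr y) a & stays C (inr y) a) ->
    False.
Proof.
suff main n (D : {set state}) : #|D| = n -> (forall s, s \in D -> 0 < V s) ->
  exists Bst : Sd -> {set A}, (forall x, 0 < theta x (Bst x)) /\
  forall C : {set state}, C != finset.set0 -> C \subset D ->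
    (forall x, inl x \in C -> exists2 a, a \in Bst x & stays C (inl x) a) ->
    (forall y, inr y \in C -> exists2 a, enabled G (inr y) a & stays C (inr y) a) ->
    False.
  have [|Bst [tB hB]] := main _ [set s | 0 < V s]%SET erefl.
    by move=> s; rewrite inE.
  exists Bst; split=> // C C0 Cpos; apply: hB => //.
  by apply/fintype.subsetP => s /Cpos; rewrite inE.
elim: n D => [|n IH] D Dn Dpos.
  have [Bst hBst] : exists Bst : Sd -> {set A}, forall x, 0 < theta x (Bst x).
    by have [Bst hBst] := choice (fun x => dist_support (theta x)); exists Bst.
  exists Bst; split=> // C C0; rewrite (cards0_eq Dn) finset.subset0.
  by rewrite (negbTE C0).
have stays_sub (C C' : {set state}) s a : C \subset C' -> stays C s a -> stays C' s a.
  by move=> CC' [ra ta]; split=> // t /ta; apply: (fintype.subsetP CC').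
have shrink (C : {set state}) s : C \subset D -> s \notin C -> C \subset D :\ s.
  by move=> CD sC; rewrite subsetD1 CD.
have step_down s : s \in D -> exists Bst : Sd -> {set A},
    (forall x, 0 < theta x (Bst x)) /\
    forall C : {set state}, C != finset.set0 -> C \subset D :\ s ->
    (forall x, inl x \in C -> exists2 a, a \in Bst x & stays C (inl x) a) ->
    (forall y, inr y \in C -> exists2 a, enabled G (inr y) a & stays C (inr y) a) ->
    False.
  move=> sD; apply: IH => [|t]; last by rewrite !inE => /andP[_]; exact: Dpos.
  by move: Dn; rewrite (cardsD1 s) sD add1n => -[].
have D0 : D != finset.set0 by rewrite -cards_eq0 Dn.
have [[x [B [xD tB noB]]]|noL] := pselect (exists x B,
    [/\ inl x \in D, 0 < theta x B & ~ exists2 a, a \in B & stays D (inl x) a]).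
  have [Bst [tBst hBst]] := step_down _ xD.
  exists (fun z => if z == x then B else Bst z); split=> [z|C C0 CD hl hr].
    by case: eqP => // ->.
  have xC : inl x \notin C.
    apply/negP => /[dup] xC /hl[a]; rewrite eqxx => aB sa.
    by apply: noB; exists a => //; exact: stays_sub sa.
  apply: (hBst C C0 (shrink _ _ CD xC)) => // z zC.
  have [a] := hl z zC; case: eqP => [zx|_]; last by exists a.
  by rewrite -zx zC in xC.
have [[y [yD noy]]|noR] := pselect (exists y, inr y \in D /\
    ~ exists2 a, enabled G (inr y) a & stays D (inr y) a).
  have [Bst [tBst hBst]] := step_down _ yD.
  exists Bst; split=> // C C0 CD hl hr; apply: (hBst C C0) => //.
  apply: shrink => //; apply/negP => /hr[a ea sa]; apply: noy.
  by exists a => //; exact: stays_sub sa.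
exfalso; apply: (no_trap D0 Dpos).
  move=> x B xD tB; have [//|no] := pselect (exists2 a, a \in B & stays D (inl x) a).
  by exfalso; apply: noL; exists x, B.
move=> y yD.
have [//|no] := pselect (exists2 a, enabled G (inr y) a & stays D (inr y) a).
by exfalso; apply: noR; exists y.
Qed.

End fixpoint.

(** By [subsolution_le_total], only a trap [C] with [V] constant and zero rewards could interfere.
    There every action played has one-step value [V], so no set with a larger minimum is in use.
    Hence [Bst x] is used at each controller state of [C] and contains a staying action, which the
    choice of [Bst] forbids. *)
Lemma dominating_sound (theta' : ms) (V : state -> R) (Bst : Sd -> {set A})
    sigma pi :
  (forall s, V s <= bellman theta' V s) ->
  (forall x, (exists B, 0 < theta' x B /\
      V (inl x) < vmin (qval G rho V (inl x)) B) \/ 0 < theta' x (Bst x)) ->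
  (forall C : {set state}, C != finset.set0 -> (forall s, s \in C -> 0 < V s) ->
    (forall x, inl x \in C -> exists2 a, a \in Bst x & stays C (inl x) a) ->
    (forall y, inr y \in C -> exists2 a, enabled G (inr y) a & stays C (inr y) a) ->
    False) ->
  complies sigma theta' -> (forall s, (expected sigma pi s rho < +oo)%E) ->
  forall s, ((V s)%:E <= expected sigma pi s rho)%E.
Proof.
move=> VB impr notrap sc fin s; rewrite (totalE rho_ge0 (fin s)) lee_fin.
apply: subsolution_le_total => // {s} [s|C m C0 m0 VC stayC].
  by apply: le_trans (VB s) _; exact: bellman_le_step.
have [d [dB sE]] := complies_selection sc.
have pick x B : 0 < theta' x B -> exists2 a, a \in B & 0 < act sigma pi (inl x) a.
  move=> tB; have [a da] := dist_support (d x B); exists a.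
    have [B0 Bs] := ms_support tB.
    by apply: contraLR da => aB; rewrite dB ?ltxx.
  rewrite /= sE (bigD1 B) //= ltr_wpDr ?mulr_gt0 // sumr_ge0 // => B' _.
  by rewrite mulr_ge0 ?dist_ge0.
apply: (notrap C C0).
- by move=> s /VC->.
- move=> x xC; case: (impr x) => [[B [tB VB']]|tB]; last first.
    by have [a aB as0] := pick _ _ tB; exists a => //; exact: stayC.
  have [a aB as0] := pick _ _ tB; have [ra ta] := stayC _ _ xC as0.
  exfalso; have := lt_le_trans VB' (vmin_le _ aB).
  rewrite /qval ra add0r (VC _ xC) (eq_bigr (fun t => trans R G (inl x) a t * m)).
    by rewrite -mulr_suml trans_sum1 ?mul1r ?ltxx //; exact: act_support as0.
  move=> t _; have [/ta/VC->//|] := boolP (0 < trans R G (inl x) a t).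
  by rewrite lt_def trans_ge0 andbT negbK => /eqP->; rewrite !mul0r.
- move=> y yC; have [a as0] := dist_support (pi y).
  exists a; first exact: (act_support (sigma := sigma) (pi := pi) (s := inr y)).
  exact: stayC.
Qed.

End guaranteed_value.

(** * A criterion transferring soundness to another multi-strategy *)

Section soundness_certificate.
Variables (R : realType) (Sd Sb A : finType) (G : game Sd Sb A).
Local Notation state := (Sd + Sb)%type.
Local Notation ms := (multistrategy R G).
Variables (r : state -> A -> rat) (b : R).
Hypothesis r_ge0 : forall s a, 0 <= r s a.
Hypothesis r_fin : sup_reward_finite R G r.

Let rho (s : state) (a : A) : R := ratr (r s a).

Let rho_ge0 s a : 0 <= rho s a. Proof. by rewrite ler0q. Qed.

Lemma reward_finite (sigma : ctrl_strategy R G) (pi : env_strategy R G) s :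
  (expected sigma pi s rho < +oo)%E.
Proof.
by apply: le_lt_trans (r_fin s); apply: ereal_sup_ubound; exists sigma, pi.
Qed.

(** Separates the game from the rounding, which then only has to keep the linear means of [v] from
    dropping and one suitable set per state in use. The witness [v] is the one-step value under the
    guaranteed value. *)
Lemma soundness_certificate (theta : ms) : ms_sound r b theta ->
  exists (v : Sd -> {set A} -> R) (Bst : Sd -> {set A}),
  (forall x, 0 < theta x (Bst x)) /\
  forall theta' : ms,
    (forall x, \sum_B theta x B * v x B <= \sum_B theta' x B * v x B) ->
    (forall x, (exists B, 0 < theta' x B /\ \sum_B theta x B * v x B < v x B) \/
       0 < theta' x (Bst x)) ->
    ms_sound r b theta'.
Proof.
move=> snd; have [[pi0 _]|no_pi] := pselect (exists pi : env_strategy R G, True); last first.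
  have [Bst hBst] := choice (fun x => dist_support (theta x)).
  exists (fun _ _ => 0), Bst; split=> // theta' _ _ sigma _ pi.
  by exfalso; apply: no_pi; exists pi.
have [f hf] : exists f : Sd -> {set A} -> A, forall x (B : {set A}),
    B != finset.set0 -> f x B \in B /\ True.
  by apply: (set_choice theta (good := fun _ _ _ => True)) => x B /set0Pn[a aB]; exists a.
have [g hg] := choice (env_enabled pi0).
have [sigma0 [pi1 [sc0 _ _]]] :=
  deterministic_strategies theta (fun x B B0 => (hf x B B0).1) hg.
have fin0 := reward_finite sigma0 pi0.
pose V := guaranteed rho theta.
have [Bst [tBst notrap]] := progress_selection rho_ge0 sc0 fin0.
have [sigma [pi [sc Eatt]]] := guaranteed_attained rho_ge0 sc0 fin0.
have bV : b <= V (init G).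
  by rewrite -lee_fin; apply: le_trans (Eatt _); exact: snd.
have VB := guaranteed_le_bellman rho_ge0 sc0 fin0.
exists (fun x => vmin (qval G rho V (inl x))), Bst; split=> // theta' dom impr sigma' sc' pi'.
apply: le_trans (_ : ((V (init G))%:E <= _)%E); first by rewrite lee_fin.
apply: (@dominating_sound R Sd Sb A G rho rho_ge0 theta' V Bst) => //.
- move=> [x|y]; last exact: (VB (inr y)).
  exact: le_trans (VB (inl x)) (dom x).
- move=> x; case: (impr x) => [[B [tB vB]]|tB]; last by right.
  by left; exists B; split=> //; apply: le_lt_trans (VB (inl x)) vB.
- exact: reward_finite.
Qed.

End soundness_certificate.

(** * Penalties, and their change under rescaled weights *)

Section penalty_theory.
Variables (R : realType) (Sd Sb A : finType) (G : game Sd Sb A).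
Local Notation state := (Sd + Sb)%type.
Local Notation ms := (multistrategy R G).
Variable psi : Sd -> A -> rat.
Hypothesis psi_ge0 : forall x a, 0 <= psi x a.

Definition blocked_cost (x : Sd) (B : {set A}) : R :=
  \sum_(a | enabled G (inl x) a && (a \notin B)) ratr (psi x a).

Definition total_cost (x : Sd) : R :=
  \sum_(a | enabled G (inl x) a) ratr (psi x a).

Lemma blocked_cost_ge0 x B : 0 <= blocked_cost x B.
Proof. by apply: sumr_ge0 => a _; rewrite ler0q. Qed.

Lemma blocked_cost_le x B : blocked_cost x B <= total_cost x.
Proof.
rewrite /total_cost (bigID (fun a => a \notin B)) /= lerDl.
by apply: sumr_ge0 => a _; rewrite ler0q.
Qed.

Lemma pen_locE (theta : ms) x : pen_loc psi theta x = \sum_B theta x B * blocked_cost x B.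
Proof.
rewrite /pen_loc big_mkcond /=; apply: eq_bigr => B _.
by case: ifPn => [_|/ms_enabled->]; rewrite ?mul0r // mulr_sumr.
Qed.

Lemma pen_loc_ge0 (theta : ms) x : 0 <= pen_loc psi theta x.
Proof.
rewrite pen_locE; apply: sumr_ge0 => B _.
by rewrite mulr_ge0 ?dist_ge0 ?blocked_cost_ge0.
Qed.

Lemma restrict_multistrategy (theta : ms) (f : Sd -> dist R {set A}) :
  (forall x B, 0 < f x B -> 0 < theta x B) ->
  exists theta' : ms, forall x B, theta' x B = f x B.
Proof.
move=> sub.
have f0 x B : theta x B = 0 -> f x B = 0.
  by move=> tB; apply: dist_eq0; apply/negP => /sub; rewrite tB ltxx.
have ne x : f x finset.set0 = 0 by rewrite f0 // ms_nonempty.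
have en x (B : {set A}) : ~~ (B \subset enabled G (inl x)) -> f x B = 0.
  by move=> dis; rewrite f0 // ms_enabled.
by exists (Multistrategy ne en).
Qed.

(** The same selection [d] is played against [theta], so factors between set weights pass on to
    action probabilities. *)
Lemma compliant_rescaling (theta theta' : ms) c sigma' :
  (forall x B, theta' x B <= c * theta x B) ->
  (forall x B, theta x B <= c * theta' x B) ->
  complies sigma' theta' -> exists sigma : ctrl_strategy R G, [/\ complies sigma theta,
    forall x a, sigma' x a <= c * sigma x a & forall x a, sigma x a <= c * sigma' x a].
Proof.
move=> h1 h2 /complies_selection[d [dB sE']].
have [sigma sc sE] := selection_complies theta dB.
exists sigma; split=> // x a; rewrite sE sE' mulr_sumr; apply: ler_sum => B _.
  by rewrite mulrA ler_wpM2r ?dist_ge0.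
by rewrite mulrA ler_wpM2r ?dist_ge0.
Qed.

(** [supersolution_perturbation] on the set [X] of states with finite expectation under [sigma],
    where [total] is a supersolution. [X] is closed under the chain of [sigma], and so under that of
    [sigma'], whose support is no larger; hence all exit weights are 0. *)
Lemma expected_rescaling (sigma sigma' : ctrl_strategy R G) (pi : env_strategy R G)
    (rho rho' : state -> R) c s0 :
  1 <= c -> (forall s, 0 <= rho s) -> (forall s, 0 <= rho' s) ->
  (forall s, rho' s <= c * rho s) ->
  (forall x a, sigma' x a <= c * sigma x a) ->
  (forall x a, sigma x a <= c * sigma' x a) ->
  (expected sigma pi s0 (fun s _ => rho s) < +oo)%E ->
  (expected sigma' pi s0 (fun s _ => rho' s) <=
   (c ^+ (3 ^ #|{: state}|) * total sigma pi (fun s _ => rho s) s0)%:E)%E.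
Proof.
move=> c1 rho0 rho'0 rr ss' s's fin0.
have c0 : 0 <= c by lra.
pose X := [set t | (expected sigma pi t (fun s _ => rho s) < +oo)%E]%SET.
have rhoA0 (s : state) (a : A) : 0 <= (fun s _ => rho s) s a by exact: rho0.
have act_le s a : act sigma' pi s a <= c * act sigma pi s a.
  by case: s => [x|y] /=; [exact: ss' | rewrite ler_peMl // dist_ge0].
have act_ge s a : act sigma pi s a <= c * act sigma' pi s a.
  by case: s => [x|y] /=; [exact: s's | rewrite ler_peMl // dist_ge0].
have act_pos s a : 0 < act sigma' pi s a -> 0 < act sigma pi s a.
  move=> s'a; have := lt_le_trans s'a (act_le s a).
  by rewrite pmulr_rgt0 //; lra.
pose P (tau : ctrl_strategy R G) s t := \sum_a act tau pi s a * trans R G s a t.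
have P0 tau s t : 0 <= P tau s t.
  by apply: sumr_ge0 => a _; rewrite mulr_ge0 ?dist_ge0 ?trans_ge0.
have out s a t : s \in X -> 0 < act sigma pi s a -> t \notin X -> trans R G s a t = 0.
  move=> sX as0 tX; apply/eqP; rewrite eq_le trans_ge0 andbT leNgt.
  by apply: contra tX => t0; exact: (total_closed rhoA0 erefl sX as0 t0).
have P1 (tau : ctrl_strategy R G) :
    (forall s a, 0 < act tau pi s a -> 0 < act sigma pi s a) ->
    forall s, s \in X -> 0 + \sum_(t in X) P tau s t = 1.
  move=> tau_sub s sX; rewrite add0r exchange_big /= -(dist_sum1 (act tau pi s)).
  apply: eq_bigr => a _; rewrite -mulr_sumr.
  have [ta|/dist_eq0->] := boolP (0 < act tau pi s a); last by rewrite mul0r.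
  rewrite -[RHS]mulr1 -(trans_sum1 R (act_support ta)); congr (_ * _).
  rewrite [RHS](bigID (mem X)) /= [X in _ = _ + X]big1 ?addr0 // => t tX.
  exact: (out s a t sX (tau_sub _ _ ta) tX).
have stepE (tau : ctrl_strategy R G) (h : state -> R) U s :
    \sum_a act tau pi s a * (h s + \sum_(t in X) trans R G s a t * U t) =
    h s + \sum_(t in X) P tau s t * U t.
  under eq_bigr do rewrite mulrDr.
  rewrite big_split /= -mulr_suml dist_sum1 mul1r; congr (_ + _).
  under eq_bigr do rewrite mulr_sumr.
  rewrite exchange_big /=; apply: eq_bigr => t _; rewrite mulr_suml.
  by apply: eq_bigr => a _; rewrite mulrA.
pose U := total sigma pi (fun s _ => rho s).
have [|||||||||||||||U' [U'0 U's U'U]] := @supersolution_perturbation R state X c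
   (P sigma) (P sigma') (fun=> 0) (fun=> 0) rho rho' U c1.
- exact: P0.
- exact: P0.
- by [].
- by [].
- exact: rho0.
- exact: rho'0.
- by move=> s; exact: total_ge0.
- exact: P1.
- exact: P1.
- move=> s t; rewrite mulr_sumr; apply: ler_sum => a _.
  by rewrite mulrA ler_wpM2r ?trans_ge0.
- move=> s t; rewrite mulr_sumr; apply: ler_sum => a _.
  by rewrite mulrA ler_wpM2r ?trans_ge0.
- by move=> s; rewrite mulr0.
- by move=> s; rewrite mulr0.
- exact: rr.
- move=> s sX; rewrite -stepE; apply: (total_super rhoA0 _ sX) => t.
  by rewrite inE.
have s0X : s0 \in X by rewrite inE.
have vi n s : s \in X -> value_iter sigma' pi (fun s _ => rho' s) n s <= U' s.
  elim: n s => [|n IH] s sX; first exact: U'0.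
  apply: le_trans (U's s sX); rewrite -stepE; apply: ler_sum => a _.
  have [as0|/dist_eq0->] := boolP (0 < act sigma' pi s a); last by rewrite !mul0r.
  rewrite ler_wpM2l ?dist_ge0 // lerD2l (bigID (mem X)) /= [X in _ + X]big1 ?addr0.
    by apply: ler_sum => t tX; rewrite ler_wpM2l ?trans_ge0 // IH.
  by move=> t tX; rewrite (out s a t sX (act_pos _ _ as0) tX) mul0r.
apply/expected_leP; first by move=> s _; exact: rho'0.
move=> n; apply: le_trans (vi n s0 s0X) _; apply: le_trans (U'U s0 s0X) _.
rewrite ler_wpM2r //; first exact: total_ge0.
rewrite ler_weXn2l // (leq_trans (leq_pred _)) // leq_exp2l //.
exact: max_card.
Qed.

End penalty_theory.

(** * Rounding a sound multi-strategy *)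

Section rounding.
Variables (R : realType) (Sd Sb A : finType) (G : game Sd Sb A).
Local Notation state := (Sd + Sb)%type.
Local Notation ms := (multistrategy R G).
Variables (r : state -> A -> rat) (b : R) (psi : Sd -> A -> rat).
Hypothesis r_ge0 : forall s a, 0 <= r s a.
Hypothesis psi_ge0 : forall s a, 0 <= psi s a.
Hypothesis r_fin : sup_reward_finite R G r.
Variable theta : ms.
Hypothesis theta_sound : ms_sound r b theta.

Lemma static_rounding M : (0 < M)%N ->
  exists theta' : ms, [/\ granular M theta', ms_sound r b theta' &
    pen_sta psi theta' <= pen_sta psi theta + (\sum_x total_cost R G psi x) / M%:R].
Proof.
move=> M0; have [v [Bst [tBst cert]]] := soundness_certificate r_ge0 r_fin theta_sound.
have H x : exists p' : dist R {set A},
    [/\ forall B, exists z : int, p' B = z%:~R / M%:R,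
    forall B, 0 < p' B -> 0 < theta x B,
    \sum_B theta x B * v x B <= \sum_B p' B * v x B,
    \sum_B p' B * blocked_cost R G psi x B <=
      \sum_B theta x B * blocked_cost R G psi x B + total_cost R G psi x / M%:R &
    (exists B, 0 < p' B /\ \sum_B theta x B * v x B < v x B) \/ 0 < p' (Bst x)].
  (* Blocked costs lie between 0 and the total cost, which therefore bounds the price of moving a
     unit of mass. *)
  apply: two_point_rounding => // B B' _ _.
  by have := blocked_cost_le R G psi_ge0 x B'; have := blocked_cost_ge0 R G psi_ge0 x B; lra.
have [f hf] := choice H.
have [theta' tE] : exists theta' : ms, forall x B, theta' x B = f x B.
  by apply: (restrict_multistrategy (theta := theta)) => x B; case: (hf x) => _ + _ _ _; exact.
have sE x (h : {set A} -> R) : \sum_B theta' x B * h B = \sum_B f x B * h B.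
  by apply: eq_bigr => B _; rewrite tE.
exists theta'; split.
- by move=> x B; rewrite tE; case: (hf x) => + _ _ _ _; exact.
- apply: cert => x; first by rewrite sE; case: (hf x).
  case: (hf x) => _ _ _ _ [[B [fB vB]]|fB]; [left; exists B|right].
    by rewrite tE.
  by rewrite tE.
- rewrite /pen_sta mulr_suml -big_split /=; apply: ler_sum => x _.
  by rewrite !pen_locE sE; case: (hf x).
Qed.

Lemma proportional_rounding (c : R) : 1 < c ->
  exists M (theta' : ms), [/\ (0 < M)%N, granular M theta', ms_sound r b theta',
    forall x B, theta' x B <= c * theta x B & forall x B, theta x B <= c * theta' x B].
Proof.
move=> c1; have [v [Bst [tBst cert]]] := soundness_certificate r_ge0 r_fin theta_sound.
have [N hN] := choice (fun x => floor_rounding (theta x) (v x) c1).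
pose M := (\max_x N x).+1.
have [f hf] := choice (fun x => hN x M (leqW (leq_bigmax x)) (ltn0Sn _)).
have [theta' tE] : exists theta' : ms, forall x B, theta' x B = f x B.
  apply: (restrict_multistrategy (theta := theta)) => x B fB; case: (hf x) => _ le _ _.
  by have := lt_le_trans fB (le B); rewrite pmulr_rgt0 //; lra.
have sE x (h : {set A} -> R) : \sum_B theta' x B * h B = \sum_B f x B * h B.
  by apply: eq_bigr => B _; rewrite tE.
exists M, theta'; split=> //.
- by move=> x B; rewrite tE; case: (hf x) => + _ _ _; exact.
- apply: cert => x; first by rewrite sE; case: (hf x).
  (* The support of [theta] is kept, so the progress set remains in use. *)
  right; rewrite tE; case: (hf x) => _ _ le _.
  by have := lt_le_trans (tBst x) (le (Bst x)); rewrite pmulr_rgt0 //; lra.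
- by move=> x B; rewrite tE; case: (hf x).
- by move=> x B; rewrite tE; case: (hf x).
Qed.

Lemma dynamic_rounding (eps : R) : 0 < eps ->
  exists M (theta' : ms), [/\ (0 < M)%N, granular M theta', ms_sound r b theta' &
    (pen_dyn psi theta' <= pen_dyn psi theta + eps%:E)%E].
Proof.
move=> eps0; pose k := (3 ^ #|{: state}|)%N.
pose Dd : R := Num.max 0 (fine (pen_dyn psi theta)).
have D0 : 0 <= Dd by rewrite le_max lexx.
have [c c1 hc] : exists2 c : R, 1 < c & c * c ^+ k * Dd <= Dd + eps.
  pose q : R := 3 ^+ k.+1 * (Dd + 1).
  have k1 : 1 <= 3 ^+ k.+1 :> R by apply: exprn_ege1; lra.
  have q0 : 0 < q by rewrite /q mulr_gt0; lra.
  (* Chosen so that [z * 3 ^+ k.+1 * Dd <= eps]; the summand 1 in [q] keeps the divisor positive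
     when [Dd = 0]. *)
  pose z := Num.min 1 (eps / q).
  have z0 : 0 < z by rewrite lt_min ltr01 divr_gt0.
  have z1 : z <= 1 by rewrite ge_min lexx.
  have zq : z * q <= eps by rewrite -ler_pdivlMr // ge_min lexx orbT.
  exists (1 + z); first by lra.
  rewrite -exprS; apply: le_trans (ler_wpM2r D0 (expr1D_le k.+1 (x := z) _)) _.
    by rewrite z1 ltW.
  have : 0 <= z * 3 ^+ k.+1 by rewrite mulr_ge0; lra.
  move: zq; rewrite /q; nra.
have [M [theta' [M0 gr snd le1 le2]]] := proportional_rounding c1.
exists M, theta'; split=> //.
have c1' : 1 <= c by exact: ltW.
apply: ge_ereal_sup => _ [sigma' [pi [sc' ->]]].
have [sigma [sc s1 s2]] := compliant_rescaling le1 le2 sc'.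
have Eub : (expected sigma pi (init G) (pen_reward psi theta) <= pen_dyn psi theta)%E.
  by apply: ereal_sup_ubound; exists sigma, pi.
pose rho (s : state) : R := if s is inl x then pen_loc psi theta x else 0.
pose rho' (s : state) : R := if s is inl x then pen_loc psi theta' x else 0.
have rho0 s : 0 <= rho s by case: s => [x|y] //=; exact: pen_loc_ge0.
have rho'0 s : 0 <= rho' s by case: s => [x|y] //=; exact: pen_loc_ge0.
have rr s : rho' s <= c * rho s.
  case: s => [x|y] /=; last by rewrite mulr0.
  rewrite !pen_locE mulr_sumr; apply: ler_sum => B _.
  by rewrite mulrA ler_wpM2r ?blocked_cost_ge0.
have Ege0 : (0 <= expected sigma pi (init G) (fun s _ => rho s))%E.
  by apply: expected_ge0.
(* An infinite penalty of [theta] makes the bound trivial, and the value -oo is excluded by the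
   nonnegative expectation of the pair at hand. *)
case pE : (pen_dyn psi theta) => [D| |]; first last.
- by have := le_trans Ege0 Eub; rewrite pE.
- by rewrite leey.
have DE : D <= Dd by rewrite /Dd pE le_max lexx orbT.
have DE' : Dd = D.
  rewrite /Dd pE /=; apply/max_idPr.
  by have := le_trans Ege0 Eub; rewrite pE lee_fin.
have fin : (expected sigma pi (init G) (fun s _ => rho s) < +oo)%E.
  by apply: le_lt_trans Eub _; rewrite pE ltry.
apply: le_trans (expected_rescaling c1' rho0 rho'0 rr s1 s2 fin) _.
rewrite -EFinD lee_fin -DE'; apply: le_trans hc.
have tD : total sigma pi (fun s _ => rho s) (init G) <= Dd.
  by rewrite DE' -lee_fin -pE; apply: le_trans Eub; rewrite -totalE.
apply: ler_pM => //.
- by rewrite exprn_ge0 //; lra.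
- exact: total_ge0.
- by rewrite ler_peMl // exprn_ge0 //; lra.
Qed.

End rounding.

(** * Both penalty types together *)

Theorem theorem4p7 (R : realType) (Sd Sb A : finType) (G : game Sd Sb A)
  (r : Sd + Sb -> A -> rat) (b : R) (psi : Sd -> A -> rat) (tau : penalty_type)
  (r_ge0 : forall s a, 0 <= r s a) (psi_ge0 : forall s a, 0 <= psi s a)
  (r_fin : sup_reward_finite R G r)
  (theta : multistrategy R G) (theta_sound : ms_sound r b theta)
  (eps : R) (eps_gt0 : 0 < eps) :
  (exists (M : nat) (theta' : multistrategy R G),
    [/\ (0 < M)%N, granular M theta', ms_sound r b theta' &
        (pen psi tau theta' <= pen psi tau theta + eps%:E)%E]) /\
  (tau = sta ->
   let M := maxn 1 `|Num.ceil (\sum_(s : Sd + Sb) \sum_(a | enabled G s a)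
                               (ratr (psi_ext psi s a) / eps))|%N in
   exists theta' : multistrategy R G,
    [/\ granular M theta', ms_sound r b theta' &
        (pen psi tau theta' <= pen psi tau theta + eps%:E)%E]).
Proof.
set K := (\sum_(s : Sd + Sb) _).
have static : let M := maxn 1 `|Num.ceil K|%N in
    exists theta' : multistrategy R G, [/\ granular M theta', ms_sound r b theta' &
      (pen psi sta theta' <= pen psi sta theta + eps%:E)%E].
  (* All penalties may be 0; the maximum with 1 keeps the denominator positive. *)
  move=> M; have M0 : (0 < M)%N by rewrite leq_max.
  have [theta' [gr snd le]] :=
    static_rounding r_ge0 psi_ge0 r_fin theta_sound M0.
  exists theta'; split=> //=; rewrite -EFinD lee_fin.
  apply: le_trans le _; rewrite lerD2l.
  (* Environment states contribute 0 to [K], so the error of [static_rounding] is [K * eps / M], at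
     most [eps] once [K <= M]. *)
  have KE : K = (\sum_x total_cost R G psi x) / eps.
    rewrite /K big_sumType /= [X in _ + X]big1 ?addr0 => [|y _]; last first.
      by rewrite big1 // => a _; rewrite rmorph0 mul0r.
    by rewrite mulr_suml; apply: eq_bigr => x _; rewrite mulr_suml.
  have KM : K <= M%:R.
    apply: le_trans (ceil_ge K) _; rewrite (pmulrn 1 M) ler_int.
    apply: le_trans (ler_norm _) _; rewrite -abszE lez_nat leq_maxr //.
  rewrite ler_pdivrMr ?ltr0n // mulrC -ler_pdivrMr // -KE //.
split; last by move=> ->.
case: tau => /=; last exact: dynamic_rounding.
have [theta' [gr snd le]] := static.
by exists (maxn 1 `|Num.ceil K|%N), theta'; split=> //; rewrite leq_max.
Qed.
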